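(* Let $k$ be a field and $B=k\langle x,y\rangle/(y^2)$ with the $\mathbb{Z}$-grading $\deg x=\deg y=1$. Every object in the abelian category $\mathsf{qgr}\,B$ is injective and projective (in $\mathsf{qgr}\,B$).
   Context: $\mathsf{gr}\,B$ is the category of finitely presented $\mathbb{Z}$-graded left $B$-modules with degree-preserving homomorphisms (it is abelian because $B$ is coherent), $\mathsf{fdim}\,B$ is its Serre subcategory of finite dimensional graded modules, and $\mathsf{qgr}\,B:=\mathsf{gr}\,B/\mathsf{fdim}\,B$ is the quotient category. *)

(* Defs.v *)
From HB Require Import structures.
From mathcomp Require Import all_boot all_algebra.
From mathcomp Require Import boolp.
From mathcomp.multinomials Require Import monalg.

Set Implicit Arguments.
Unset Strict Implicit.
Unset Printing Implicit Defensive.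

Import GRing.Theory.
Local Open Scope ring_scope.
Local Open Scope quotient_scope.

(* Categories are taken with setoid hom-sets: [heq] is the equality of
   morphisms. This lets a localization be presented by generators and
   relations without forming quotient types. *)
Record category := Category {
  obj :> Type;
  hom : obj -> obj -> Type;
  heq : forall X Y, hom X Y -> hom X Y -> Prop;
  idm : forall X, hom X X;
  comp : forall X Y Z, hom Y Z -> hom X Y -> hom X Z;
  heq_refl : forall X Y (f : hom X Y), heq f f;
  heq_sym : forall X Y (f g : hom X Y), heq f g -> heq g f;
  heq_trans : forall X Y (f g h : hom X Y), heq f g -> heq g h -> heq f h;
  comp_heq : forall X Y Z (g g' : hom Y Z) (f f' : hom X Y),
    heq g g' -> heq f f' -> heq (comp g f) (comp g' f');
  comp_idl : forall X Y (f : hom X Y), heq (comp (idm Y) f) f;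
  comp_idr : forall X Y (f : hom X Y), heq (comp f (idm X)) f;
  comp_assoc : forall X Y Z T (h : hom Z T) (g : hom Y Z) (f : hom X Y),
    heq (comp h (comp g f)) (comp (comp h g) f)
}.
Arguments hom {c} X Y.
Arguments heq {c X Y} f g.
Arguments idm {c} X.
Arguments comp {c X Y Z} g f.

Declare Scope cat_scope.
Delimit Scope cat_scope with cat.
Local Open Scope cat_scope.
Notation "f ~~ g" := (heq f g) (at level 70, no associativity) : cat_scope.

Notation "g \o f" := (comp g f) : cat_scope.

Section CategoryTheory.
Variable C : category.

Definition monic (X Y : C) (f : hom X Y) : Prop :=
  forall (T : C) (g h : hom T X), f \o g ~~ f \o h -> g ~~ h.

Definition epic (X Y : C) (f : hom X Y) : Prop :=
  forall (T : C) (g h : hom Y T), g \o f ~~ h \o f -> g ~~ h.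

Definition injective_obj (I : C) : Prop :=
  forall (X Y : C) (f : hom X Y), monic f ->
  forall g : hom X I, exists h : hom Y I, h \o f ~~ g.

Definition projective_obj (P : C) : Prop :=
  forall (X Y : C) (f : hom X Y), epic f ->
  forall g : hom P Y, exists h : hom P X, f \o h ~~ g.

Definition zero_obj (Z : C) : Prop :=
  forall X : C, (exists f : hom X Z, forall g, g ~~ f) /\
                (exists f : hom Z X, forall g, g ~~ f).

Definition zero_mor (X Y : C) (f : hom X Y) : Prop :=
  exists (Z : C) (g : hom X Z) (h : hom Z Y), zero_obj Z /\ f ~~ h \o g.

Definition is_kernel (X Y K : C) (f : hom X Y) (i : hom K X) : Prop :=
  zero_mor (f \o i) /\
  forall (T : C) (g : hom T X), zero_mor (f \o g) ->
  exists h : hom T K, i \o h ~~ g /\ forall h', i \o h' ~~ g -> h' ~~ h.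

Definition is_cokernel (X Y Q : C) (f : hom X Y) (p : hom Y Q) : Prop :=
  zero_mor (p \o f) /\
  forall (T : C) (g : hom Y T), zero_mor (g \o f) ->
  exists h : hom Q T, h \o p ~~ g /\ forall h', h' \o p ~~ g -> h' ~~ h.

End CategoryTheory.

(* Gabriel-Zisman localization of [C] at a class [W] of morphisms: the morphisms
   are composites of morphisms of [C] and formal inverses of members of [W],
   modulo the congruence generated by the relations of [C] and the equations
   saying that the formal inverses are two-sided inverses. *)
Section Localization.
Variables (C : category) (W : forall X Y : C, hom X Y -> Prop).

Inductive zigzag : C -> C -> Type :=
| zz_of (X Y : C) (f : hom X Y) : zigzag X Y
| zz_inv (X Y : C) (f : hom X Y) (Wf : W f) : zigzag Y X
| zz_comp (X Y Z : C) (g : zigzag Y Z) (f : zigzag X Y) : zigzag X Z.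

Inductive zz_eq : forall X Y : C, zigzag X Y -> zigzag X Y -> Prop :=
| zz_refl X Y (f : zigzag X Y) : zz_eq f f
| zz_sym X Y (f g : zigzag X Y) : zz_eq f g -> zz_eq g f
| zz_trans X Y (f g h : zigzag X Y) : zz_eq f g -> zz_eq g h -> zz_eq f h
| zz_comp_eq X Y Z (g g' : zigzag Y Z) (f f' : zigzag X Y) :
    zz_eq g g' -> zz_eq f f' -> zz_eq (zz_comp g f) (zz_comp g' f')
| zz_idl X Y (f : zigzag X Y) : zz_eq (zz_comp (zz_of (idm Y)) f) f
| zz_idr X Y (f : zigzag X Y) : zz_eq (zz_comp f (zz_of (idm X))) f
| zz_assoc X Y Z T (h : zigzag Z T) (g : zigzag Y Z) (f : zigzag X Y) :
    zz_eq (zz_comp h (zz_comp g f)) (zz_comp (zz_comp h g) f)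
| zz_of_eq X Y (f g : hom X Y) : f ~~ g -> zz_eq (zz_of f) (zz_of g)
| zz_of_comp X Y Z (g : hom Y Z) (f : hom X Y) :
    zz_eq (zz_of (g \o f)) (zz_comp (zz_of g) (zz_of f))
| zz_invl X Y (f : hom X Y) (Wf : W f) :
    zz_eq (zz_comp (zz_inv Wf) (zz_of f)) (zz_of (idm X))
| zz_invr X Y (f : hom X Y) (Wf : W f) :
    zz_eq (zz_comp (zz_of f) (zz_inv Wf)) (zz_of (idm Y)).

Definition localization : category :=
  Category zz_refl zz_sym zz_trans zz_comp_eq zz_idl zz_idr zz_assoc.

End Localization.

(* The Serre quotient [C/S] is the localization of [C] at the morphisms whose
   kernel and cokernel belong to [S]. *)
Section SerreQuotient.
Variables (C : category) (S : C -> Prop).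

Definition serre_iso (X Y : C) (f : hom X Y) : Prop :=
  (exists (K : C) (i : hom K X), is_kernel f i /\ S K) /\
  (exists (Q : C) (p : hom Y Q), is_cokernel f p /\ S Q).

Definition serre_quotient : category := localization serre_iso.

End SerreQuotient.

Definition is_grading (V : zmodType) (V_ : int -> V -> Prop) : Prop :=
  [/\ forall i, V_ i 0 /\ forall u v, V_ i u -> V_ i v -> V_ i (u - v),
      forall v, exists (s : seq int) (f : int -> V),
        (forall i, V_ i (f i)) /\ v = \sum_(i <- s) f i
    & forall (s : seq int) (f : int -> V), uniq s ->
        (forall i, V_ i (f i)) -> \sum_(i <- s) f i = 0 ->
        forall i, i \in s -> f i = 0].

(* [A] is a ring graded by [A_], made into a [k]-algebra by [sc : k -> A]. *)
Section GradedModules.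
Variables (k : fieldType) (A : pzRingType) (sc : k -> A).
Variable A_ : int -> A -> Prop.

(* A presentation (+)_l A(- e l) -> (+)_j A(- d j) -> M -> 0 by graded free
   modules of finite rank: the j-th basis vector goes to [x j], of degree
   [d j], and the l-th one to the homogeneous row [r l], of degree [e l]. *)
Definition graded_fin_pres (M : lmodType A) (M_ : int -> M -> Prop) : Prop :=
  exists (n : nat) (d : 'I_n -> int) (x : 'I_n -> M)
         (p : nat) (e : 'I_p -> int) (r : 'I_p -> 'I_n -> A),
  [/\ forall j, M_ (d j) (x j),
      forall l j, A_ (e l - d j) (r l j),
      forall m, exists c : 'I_n -> A, m = \sum_j c j *: x j
    & forall c : 'I_n -> A, \sum_j c j *: x j = 0 <->
        exists a : 'I_p -> A, forall j, c j = \sum_l a l * r l j].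

Record grmod := GrMod {
  gm_mod :> lmodType A;
  gm_deg : int -> gm_mod -> Prop;
  gm_grading : is_grading gm_deg;
  gm_scale : forall i j (a : A) (m : gm_mod),
    A_ i a -> gm_deg j m -> gm_deg (i + j) (a *: m);
  gm_fin_pres : graded_fin_pres gm_deg
}.

Record grhom (M N : grmod) := GrHom {
  gh_fun :> {linear M -> N};
  gh_deg : forall i m, gm_deg i m -> gm_deg i (gh_fun m)
}.

Definition grhom_eq M N (f g : grhom M N) : Prop := f =1 g.

Definition grhom_id (M : grmod) : grhom M M :=
  @GrHom M M (idfun : {linear M -> M}) (fun i m Mm => Mm).

Definition grhom_comp (L M N : grmod) (g : grhom M N) (f : grhom L M) :
    grhom L N :=
  @GrHom L N (ssrfun.comp g f : {linear L -> N})
         (fun i m Lm => gh_deg g (gh_deg f Lm)).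

Definition gr : category.
Proof.
refine (@Category grmod grhom grhom_eq grhom_id grhom_comp _ _ _ _ _ _ _).
- by move=> M N f m.
- by move=> M N f g fg m; rewrite fg.
- by move=> M N f g h fg gh m; rewrite fg gh.
- by move=> L M N g g' f f' gg' ff' m /=; rewrite ff' gg'.
- by move=> M N f m.
- by move=> M N f m.
- by move=> K L M N h g f m.
Defined.

Definition fdim (M : gr) : Prop :=
  exists (n : nat) (x : 'I_n -> gm_mod M),
  forall m, exists c : 'I_n -> k, m = \sum_i sc (c i) *: x i.

Definition qgr : category := serre_quotient fdim.

End GradedModules.

(* The library only forms quotients of commutative rings by ideals; here is the
   quotient of a ring by the two-sided ideal generated by one element. *)
Section PrincipalQuotient.
Variables (R : pzRingType) (a : R).

Definition ideal_gen : {pred R} := fun u =>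
  `[< exists s : seq (R * R), u = \sum_(p <- s) p.1 * a * p.2 >].

Fact ideal_gen_zmod : zmod_closed ideal_gen.
Proof.
split=> [|u v /asboolP[s ->] /asboolP[t ->]]; apply/asboolP.
  by exists [::]; rewrite big_nil.
exists (s ++ [seq (- p.1, p.2) | p <- t]); rewrite big_cat big_map -sumrN /=.
by congr (_ + _); apply: eq_bigr => p _; rewrite !mulNr.
Qed.
HB.instance Definition _ := GRing.isZmodClosed.Build R ideal_gen ideal_gen_zmod.

Lemma ideal_genMl b u : u \in ideal_gen -> b * u \in ideal_gen.
Proof.
move=> /asboolP[s ->]; apply/asboolP; exists [seq (b * p.1, p.2) | p <- s].
by rewrite big_map mulr_sumr; apply: eq_bigr => p _; rewrite !mulrA.
Qed.

Lemma ideal_genMr b u : u \in ideal_gen -> u * b \in ideal_gen.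
Proof.
move=> /asboolP[s ->]; apply/asboolP; exists [seq (p.1, p.2 * b) | p <- s].
by rewrite big_map mulr_suml; apply: eq_bigr => p _; rewrite !mulrA.
Qed.

Definition pquot : Type := Quotient.quot ideal_gen.
HB.instance Definition _ := GRing.Zmodule.on pquot.

Lemma pquot_eqE (u v : R) :
  (\pi_pquot u == \pi_pquot v) = (u - v \in ideal_gen).
Proof. by rewrite piE Quotient.equivE. Qed.

Definition pquot_one : pquot := \pi_pquot 1.
Definition pquot_mul (u v : pquot) : pquot := \pi_pquot (repr u * repr v).

Lemma pquot_mulE (u v : R) :
  pquot_mul (\pi_pquot u) (\pi_pquot v) = \pi_pquot (u * v).
Proof.
apply/eqP; rewrite pquot_eqE.
set u' := repr _; set v' := repr _.
have -> : u' * v' - u * v = (u' - u) * v' + u * (v' - v).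
  by rewrite mulrBl mulrBr addrA subrK.
have reprI w : repr (\pi_pquot w) - w \in ideal_gen.
  by rewrite -pquot_eqE reprK.
by apply: rpredD; [apply: ideal_genMr | apply: ideal_genMl]; apply: reprI.
Qed.

Lemma pquot_addE (u v : R) : \pi_pquot (u + v) = \pi_pquot u + \pi_pquot v.
Proof. by rewrite !piE. Qed.

Fact pquot_mulA : associative pquot_mul.
Proof.
move=> u v w; rewrite -[u]reprK -[v]reprK -[w]reprK.
rewrite (pquot_mulE (repr v) (repr w)) (pquot_mulE (repr u) (repr v)).
by rewrite !pquot_mulE mulrA.
Qed.

Fact pquot_mul1l : left_id pquot_one pquot_mul.
Proof. by move=> u; rewrite -[u]reprK pquot_mulE mul1r. Qed.

Fact pquot_mul1r : right_id pquot_one pquot_mul.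
Proof. by move=> u; rewrite -[u]reprK pquot_mulE mulr1. Qed.

Fact pquot_mulDl : left_distributive pquot_mul +%R.
Proof.
move=> u v w; rewrite -[u]reprK -[v]reprK -[w]reprK.
by rewrite -pquot_addE !pquot_mulE -pquot_addE mulrDl.
Qed.

Fact pquot_mulDr : right_distributive pquot_mul +%R.
Proof.
move=> u v w; rewrite -[u]reprK -[v]reprK -[w]reprK.
by rewrite -pquot_addE !pquot_mulE -pquot_addE mulrDr.
Qed.

HB.instance Definition _ := GRing.Zmodule_isPzRing.Build pquot
  pquot_mulA pquot_mul1l pquot_mul1r pquot_mulDl pquot_mulDr.

End PrincipalQuotient.

Section PenroseAlgebra.
Variable k : fieldType.

(* [{malg k[{fmonom 'I_2}]}] is the monoid algebra of the free monoid on two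
   letters, i.e. the free algebra k<x, y>; letter 0 is x and letter 1 is y. *)
Definition free2 := {malg k[{fmonom 'I_2}]}.
Definition free_x : free2 := << fmu (0 : 'I_2) >>.
Definition free_y : free2 := << fmu (1 : 'I_2) >>.

Definition B : pzRingType := pquot (free_y ^+ 2).
Definition B_pi (u : free2) : B := \pi_(pquot (free_y ^+ 2)) u.

Definition B_scalar (c : k) : B := B_pi c%:MP.

(* The part of degree [i] is spanned by the images of the words of length [i];
   it is zero for [i] negative. *)
Definition B_deg (i : int) (b : B) : Prop :=
  exists u : free2,
    (forall w, u@_w != 0 -> (fdeg w)%:Z = i) /\ b = B_pi u.

Definition qgrB : category := qgr B_scalar B_deg.

End PenroseAlgebra.

(* Main.v *)
Require Import Defs.
From mathcomp Require Import all_boot all_algebra.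
From HB Require Import structures.
From Stdlib Require Import Setoid Morphisms.
From mathcomp Require Import all_order boolp zify.
From mathcomp.finmap Require Import finmap.
From mathcomp.multinomials Require Import monalg.

Set Implicit Arguments.
Unset Strict Implicit.
Unset Printing Implicit Defensive.

Import Order.TTheory GRing.Theory Num.Theory.
Local Open Scope ring_scope.

Local Open Scope quotient_scope.
(** Call a category von Neumann regular when each morphism f has a
quasi-inverse, a morphism g with f g f = f. There a monomorphism is split, and so
is an epimorphism, hence all objects are injective and projective
([regular_inj_proj]). The proof shows that qgr B is von Neumann regular.

A finitely presented graded B-module M is simple to describe in large degrees.
As soon as m exceeds the degrees of the generators and relations of a
presentation, M_(m+1) is the direct sum of x M_m and y M_m, the map
x : M_m -> M_(m+1) is injective, and the kernel of y : M_m -> M_(m+1) is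
y M_(m-1) ([regular_exists]). These properties come from the same ones of
B, where a nonzero word starts with x or with y and where y b = 0 only for b in
y B. They imply that a basis u of x M_(n-1) together with a basis v of
y M_(n-1) generates the part of degree at least n of M, which is then the direct
sum of the B u_i, each isomorphic to B, and of the B v_j, each isomorphic to
B/By. Inside B v_j the submodule B x v_j is free and has codimension one. So
the free module on the u_i, of degree n, and the x v_j, of degree n + 1, embeds
into M with finite dimensional cokernel, and this embedding is an isomorphism in
qgr B ([nb_hom_serre_iso]).

A degree preserving homomorphism f : M -> N satisfies f (x w) = x (f w) and
f (y w) = y (f w), so it maps x M_(n-1) into x N_(n-1) and y M_(n-1) into
y N_(n-1). In the bases above it is therefore a pair of matrices over k
([hom_diag]), and a pair of matrices has a quasi-inverse, taken blockwise.

A morphism of qgr B is a composite of homomorphisms and of formal inverses of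
homomorphisms. By induction on this composite it is also given, for all large
n, by a pair of matrices ([all_tracked]); for the inverse of s the pair is the
quasi-inverse of that of s, because a quasi-inverse of an isomorphism is its
inverse ([inverse_square]). Quasi-inverses of matrices then yield
quasi-inverses in qgr B ([qgr_regular]). *)

(** * Gradings and component operators *)

Lemma sum_widen (V : zmodType) (T : eqType) (a r : seq T) (h : T -> V) :
    uniq a -> uniq r -> {subset a <= r} -> (forall j, j \notin a -> h j = 0) ->
  \sum_(j <- a) h j = \sum_(j <- r) h j.
Proof.
move=> ua ur ar ha; rewrite [RHS](bigID (mem a)) /= [X in _ = _ + X]big1 //.
rewrite addr0 -[RHS]big_filter; apply: perm_big; apply: uniq_perm => //.
  by rewrite filter_uniq.
by move=> j; rewrite mem_filter /=; case ja: (j \in a) => //=; rewrite ar.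
Qed.

Section Components.
Variables (V : zmodType) (V_ : int -> V -> Prop).

(** A grading is handled through its projections [pr i] onto the homogeneous
components: sums, quotients and free modules are graded by writing down their
projections. *)
Definition components (pr : int -> V -> V) : Prop :=
  [/\ forall i u v, pr i (u - v) = pr i u - pr i v,
      forall i v, V_ i (pr i v),
      forall i j v, V_ i v -> pr j v = if i == j then v else 0
    & forall v, exists2 s, uniq s & v = \sum_(i <- s) pr i v].

Lemma components_grading pr : components pr -> is_grading V_.
Proof.
move=> [prB prV prE prS].
have pr0 i : pr i 0 = 0 by have := prB i 0 0; rewrite !subrr.
have prN i v : pr i (- v) = - pr i v by rewrite -sub0r prB pr0 sub0r.
have prD i u v : pr i (u + v) = pr i u + pr i v.
  by rewrite -{1}(opprK v) prB prN opprK.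
split=> [i|v|s f us fV].
- split=> [|u v ui vi].
    by rewrite -(pr0 i); apply: prV.
  suff <- : pr i (u - v) = u - v by apply: prV.
  by rewrite prB (prE _ i _ ui) (prE _ i _ vi) eqxx.
- by have [s _ vs] := prS v; exists s, (pr ^~ v).
move=> s0 i si; have := congr1 (pr i) s0; rewrite pr0 => <-.
have -> : pr i (\sum_(j <- s) f j) = \sum_(j <- s) pr i (f j).
  exact: (big_morph (pr i) (prD i) (pr0 i)).
rewrite (bigD1_seq i) //= (prE i i) // eqxx big1 ?addr0 // => j ji.
by rewrite (prE j i) // (negPf ji).
Qed.

Lemma grading_components : is_grading V_ -> exists pr, components pr.
Proof.
move=> [V_B V_S V_I].
have V0 i : V_ i 0 by have [] := V_B i.
have VB i u v : V_ i u -> V_ i v -> V_ i (u - v) by have [_] := V_B i; apply.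
have VN i v : V_ i v -> V_ i (- v) by rewrite -sub0r; apply: VB.
have VD i u v : V_ i u -> V_ i v -> V_ i (u + v).
  by move=> ui vi; rewrite -(opprK v); apply/VB/VN.
(* Decompositions normalized so that the family vanishes off its index set. *)
pose dec v (sf : seq int * (int -> V)) :=
  [/\ uniq sf.1, forall i, V_ i (sf.2 i), forall i, i \notin sf.1 -> sf.2 i = 0
    & v = \sum_(i <- sf.1) sf.2 i].
have decE v : exists sf, dec v sf.
  have [s [f [fV ->]]] := V_S v; elim: s => [|i s [[t g] [/= ut gV gt sE]]].
    by exists ([::], fun=> 0); split=> //=; rewrite !big_nil.
  rewrite big_cons sE; exists (undup (i :: t), fun j => g j + if j == i then f i else 0).
  split=> /= [|j|j|]; first exact: (undup_uniq (i :: t)).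
  - by case: eqP => [->|_]; [apply: VD | rewrite addr0].
  - have -> : (j \notin (if i \in t then undup t else i :: undup t)) =
              (j \notin i :: t) by rewrite -(mem_undup (i :: t)).
    by rewrite inE negb_or => /andP[/negPf -> /gt ->]; rewrite addr0.
  rewrite -[if _ then _ else _]/(undup (i :: t)) big_split /= addrC.
  rewrite -[if _ then _ else _]/(undup (i :: t)); congr (_ + _).
    rewrite (bigD1_seq i) ?undup_uniq ?mem_undup ?mem_head // eqxx.
    by rewrite big1 /= ?addr0 // => j /negPf ->.
  by apply: sum_widen; rewrite ?undup_uniq // => j jt; rewrite mem_undup inE jt orbT.
have [c cP] := choice decE.
(* Two decompositions of v agree: compare them on the union of their supports. *)
have decU v sf sf' : dec v sf -> dec v sf' -> sf.2 =1 sf'.2.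
  case: sf sf' => s f [t g] [/= us fV fs ->] [/= ut gV gt E] i.
  pose r := undup (s ++ t).
  have sr : {subset s <= r} by move=> j js; rewrite mem_undup mem_cat js.
  have tr : {subset t <= r} by move=> j jt; rewrite mem_undup mem_cat jt orbT.
  have E' : \sum_(j <- r) (f j - g j) = 0.
    rewrite sumrB -(sum_widen us) ?undup_uniq // E.
    by rewrite (sum_widen ut _ tr) ?undup_uniq ?subrr.
  have [ir|] := boolP (i \in r).
    by apply/eqP; rewrite -subr_eq0; apply/eqP/(V_I r (fun j => f j - g j)) => //;
       rewrite ?undup_uniq // => j; apply: VB.
  by rewrite mem_undup mem_cat negb_or => /andP[/fs -> /gt ->].
have decP v i f : dec v f -> (c v).2 i = f.2 i.
  by move=> vf; apply: decU (cP v) vf i.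
pose pr i v := (c v).2 i.
have prE i j v : V_ i v -> pr j v = if i == j then v else 0.
  move=> vi; rewrite /pr (decP v j ([:: i], fun j => if i == j then v else 0)) //.
  split=> //= [j'|j'|]; first by case: eqP => // <-.
    by rewrite inE eq_sym => /negPf ->.
  by rewrite big_seq1 eqxx.
exists pr; split=> // [i u v|i v|v]; last 2 first.
- by have [] := cP v.
- by have [us _ _ vE] := cP v; exists (c v).1.
have [us uV u0 uE] := cP u; have [vs vV v0 vE] := cP v.
pose r := undup ((c u).1 ++ (c v).1).
have ur : {subset (c u).1 <= r} by move=> j js; rewrite mem_undup mem_cat js.
have vr : {subset (c v).1 <= r}.
  by move=> j jt; rewrite mem_undup mem_cat jt orbT.
rewrite /pr (decP (u - v) i (r, fun j => (c u).2 j - (c v).2 j)) //.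
split=> /= [|j|j|]; rewrite ?undup_uniq //; first exact: VB.
  rewrite mem_undup mem_cat negb_or => /andP[/u0 -> /v0 ->].
  by rewrite subrr.
rewrite sumrB {1}uE {1}vE (sum_widen us _ ur) ?(sum_widen vs _ vr) //;
  exact: undup_uniq.
Qed.

End Components.
(** * Algebras with a basis of words *)

(** The monoid algebra of the free monoid on [I], given by its basis of words:
[mono c w] is c times the word w. *)
Record word_algebra (k : fieldType) (I : finType) (F : pzRingType) := WordAlgebra {
  mono : k -> seq I -> F;
  wcoef : seq I -> F -> k;
  supp : F -> seq (seq I);
  monoD : forall c d w, mono (c + d) w = mono c w + mono d w;
  monoM : forall c d v w, mono c v * mono d w = mono (c * d) (v ++ w);
  mono1 : mono 1 [::] = 1;
  wcoefD : forall w u v, wcoef w (u + v) = wcoef w u + wcoef w v;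
  wcoefU : forall c v w, wcoef w (mono c v) = if v == w then c else 0;
  supp_uniq : forall u, uniq (supp u);
  wcoef_supp : forall u w, w \notin supp u -> wcoef w u = 0;
  supp_sum : forall u, u = \sum_(w <- supp u) mono (wcoef w u) w
}.

Lemma morph_add0 (U V : zmodType) (f : U -> V) :
  {morph f : u v / u + v} -> f 0 = 0.
Proof. by move=> fD; apply: (addrI (f 0)); rewrite -fD !addr0. Qed.

Lemma morph_addN (U V : zmodType) (f : U -> V) :
  {morph f : u v / u + v} -> {morph f : u / - u}.
Proof.
by move=> fD u; apply: (addrI (f u)); rewrite -fD !subrr (morph_add0 fD).
Qed.

Section WordAlgebra.
Variables (k : fieldType) (I : finType) (F : pzRingType).
Variable (W : word_algebra k I F).
Local Notation mono := (mono W).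
Local Notation wcoef := (wcoef W).
Local Notation supp := (supp W).
Implicit Types (c d : k) (u v z : F) (w : seq I) (i j : I).

Lemma mono0 w : mono 0 w = 0.
Proof. exact: (morph_add0 (fun c d => monoD W c d w)). Qed.

Lemma wcoef0 w : wcoef w 0 = 0.
Proof. exact: morph_add0 (wcoefD W w). Qed.

Lemma wcoefN w u : wcoef w (- u) = - wcoef w u.
Proof. exact: morph_addN (wcoefD W w) u. Qed.

Lemma wcoef_ext u : (forall w, wcoef w u = 0) -> u = 0.
Proof.
by move=> u0; rewrite (supp_sum W u) big1 // => w _; rewrite u0 mono0.
Qed.

Lemma word_ind (P : F -> Prop) :
  (forall c w, P (mono c w)) -> (forall u v, P u -> P v -> P (u + v)) ->
  forall u, P u.
Proof.
move=> Pm PD u; rewrite (supp_sum W u).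
by apply: big_ind => //; rewrite -(mono0 [::]).
Qed.

Section Extension.
Variables (V : zmodType) (h : k -> seq I -> V).
Hypothesis hD : forall c d w, h (c + d) w = h c w + h d w.

Definition extend u : V := \sum_(w <- supp u) h (wcoef w u) w.

Let h0 w : h 0 w = 0.
Proof. exact: (morph_add0 (fun c d => hD c d w)). Qed.

Let extend_widen u r : uniq r -> {subset supp u <= r} ->
  extend u = \sum_(w <- r) h (wcoef w u) w.
Proof.
move=> ur ru; apply: sum_widen => //; first exact: supp_uniq.
by move=> w /wcoef_supp ->.
Qed.

Lemma extendD u v : extend (u + v) = extend u + extend v.
Proof.
pose r := undup (supp u ++ supp v ++ supp (u + v)).
have ur : uniq r by apply: undup_uniq.
have ru : {subset supp u <= r} by move=> w; rewrite mem_undup !mem_cat => ->.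
have rv : {subset supp v <= r}.
  by move=> w; rewrite mem_undup !mem_cat => ->; rewrite orbT.
have ruv : {subset supp (u + v) <= r}.
  by move=> w; rewrite mem_undup !mem_cat => ->; rewrite !orbT.
rewrite (extend_widen ur ru) (extend_widen ur rv) (extend_widen ur ruv).
by rewrite -big_split; apply: eq_bigr => w _; rewrite wcoefD hD.
Qed.

Lemma extend_mono c w : extend (mono c w) = h c w.
Proof.
pose r := undup (w :: supp (mono c w)).
rewrite (extend_widen (undup_uniq (w :: supp (mono c w)))); last first.
  by move=> v vu; rewrite mem_undup inE vu orbT.
rewrite (bigD1_seq w) ?undup_uniq ?mem_undup ?mem_head // wcoefU eqxx.
by rewrite big1 /= ?addr0 // => v; rewrite wcoefU eq_sym => /negPf ->.
Qed.

End Extension.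

Lemma additive_wordE (V : zmodType) (f g : F -> V) :
  {morph f : u v / u + v} -> {morph g : u v / u + v} ->
  (forall c w, f (mono c w) = g (mono c w)) -> f =1 g.
Proof.
move=> fD gD fg; apply: word_ind => // u v fu fv.
by rewrite fD gD fu fv.
Qed.

Definition wscalar c := mono c [::].
Definition letter i := mono 1 [:: i].

Lemma letter_mono i c w : letter i * mono c w = mono c (i :: w).
Proof. by rewrite /letter monoM mul1r. Qed.

Lemma wscalar_mono c d w : wscalar c * mono d w = mono (c * d) w.
Proof. by rewrite /wscalar monoM. Qed.

Lemma wscalarC c u : wscalar c * u = u * wscalar c.
Proof.
apply: (@additive_wordE F ( *%R (wscalar c)) ( *%R^~ (wscalar c))) => [v z|v z|d w].
- by rewrite mulrDr.
- by rewrite mulrDl.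
by rewrite !monoM cats0 mulrC.
Qed.

(** The left derivative along the letter i is the left inverse of left
multiplication by i that kills the words with another first letter. *)
Definition lderiv i := extend (fun c w =>
  if w is j :: v then if j == i then mono c v else 0 else 0).

Lemma lderivD i u v : lderiv i (u + v) = lderiv i u + lderiv i v.
Proof.
apply: extendD => c d [|j w]; first by rewrite addr0.
by case: ifP => _; rewrite ?monoD ?addr0.
Qed.

Lemma lderiv0 i : lderiv i 0 = 0.
Proof. exact: morph_add0 (lderivD i). Qed.

Lemma lderiv_mono i c w : lderiv i (mono c w) =
  if w is j :: v then if j == i then mono c v else 0 else 0.
Proof.
apply: extend_mono => {}c d [|j v]; first by rewrite addr0.
by case: ifP => _; rewrite ?monoD ?addr0.
Qed.

Lemma lderiv_letter i j u :
  lderiv i (letter j * u) = if j == i then u else 0.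
Proof.
move: u; apply: word_ind => [c w|u v IHu IHv].
  by rewrite letter_mono lderiv_mono.
by rewrite mulrDr lderivD IHu IHv; case: ifP; rewrite ?addr0.
Qed.

Lemma lderivC i c u : lderiv i (wscalar c * u) = wscalar c * lderiv i u.
Proof.
move: u; apply: word_ind => [d [|j w]|u v IHu IHv].
- by rewrite wscalar_mono !lderiv_mono mulr0.
- rewrite wscalar_mono !lderiv_mono; case: ifP; rewrite ?mulr0 //.
  by rewrite wscalar_mono.
by rewrite mulrDr !lderivD mulrDr IHu IHv.
Qed.

(** A word is empty or starts with exactly one letter. *)
Lemma word_decomp u :
  u = wscalar (wcoef [::] u) + \sum_i letter i * lderiv i u.
Proof.
move: u; apply: word_ind => [c [|j w]|u v IHu IHv].
- by rewrite wcoefU eqxx big1 ?addr0 // => i _; rewrite lderiv_mono mulr0.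
- rewrite wcoefU /wscalar mono0 add0r (bigD1 j) //= big1 ?addr0.
    by rewrite lderiv_mono eqxx letter_mono.
  by move=> i; rewrite eq_sym lderiv_mono => /negPf ->; rewrite mulr0.
rewrite {1}IHu {1}IHv wcoefD /wscalar monoD addrACA; congr (_ + _).
by rewrite -big_split; apply: eq_bigr => i _; rewrite lderivD mulrDr.
Qed.

Definition wdeg (i : int) u : Prop :=
  forall w, wcoef w u != 0 -> (size w)%:Z = i.

Definition wcomp (n : int) := extend (fun c w =>
  if (size w)%:Z == n then mono c w else 0).

Lemma wcompD n u v : wcomp n (u + v) = wcomp n u + wcomp n v.
Proof. by apply: extendD => c d w; case: ifP => _; rewrite ?monoD ?addr0. Qed.

Lemma wcomp0 n : wcomp n 0 = 0.
Proof. exact: morph_add0 (wcompD n). Qed.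

Lemma wcompN n u : wcomp n (- u) = - wcomp n u.
Proof. exact: morph_addN (wcompD n) u. Qed.

Lemma wcomp_mono n c w :
  wcomp n (mono c w) = if (size w)%:Z == n then mono c w else 0.
Proof. by apply: extend_mono => {}c d v; case: ifP => _; rewrite ?monoD ?addr0. Qed.

Lemma wcoef_wcomp n w u : wcoef w (wcomp n u) = if (size w)%:Z == n then wcoef w u else 0.
Proof.
move: u; apply: word_ind => [c v|u v IHu IHv].
  rewrite wcomp_mono; case: (altP (v =P w)) => [->|vw].
    by case: ifP; rewrite ?wcoefU ?eqxx ?wcoef0.
  by case: ifP; rewrite !wcoefU ?wcoef0 (negPf vw); case: ifP.
by rewrite wcompD !wcoefD IHu IHv; case: ifP; rewrite ?addr0.
Qed.

End WordAlgebra.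
(** * The algebra k<x, y>/(y^2) *)

(** The properties of B = k<x, y>/(y^2) that determine the modules over it in
large degrees. Besides the grading, they say that the augmentation ideal is the
direct sum of xB and yB, that xB is free on x, and that the right annihilator
of y is yB. *)
Record penrose_algebra (k : fieldType) (A : pzRingType) (sc : k -> A)
    (A_ : int -> A -> Prop) (x y : A) : Prop := PenroseAlgebra {
  sc_one : sc 1 = 1;
  sc_add : forall c d, sc (c + d) = sc c + sc d;
  sc_mul : forall c d, sc (c * d) = sc c * sc d;
  sc_inj0 : forall c, sc c = 0 -> c = 0;
  sc_central : forall c a, sc c * a = a * sc c;
  A_grading : is_grading A_;
  A_mul : forall i j a b, A_ i a -> A_ j b -> A_ (i + j) (a * b);
  A_neg : forall n a, A_ (Negz n) a -> a = 0;
  A_0 : forall a, A_ 0 a <-> exists c, a = sc c;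
  A_x : A_ 1 x;
  A_y : A_ 1 y;
  A_split : forall (n : nat) a, A_ n.+1%:Z a ->
    exists b c, [/\ A_ n b, A_ n c & a = x * b + y * c];
  A_indep : forall b c, x * b + y * c = 0 -> b = 0 /\ y * c = 0;
  A_yy : y * y = 0;
  A_kery : forall b, y * b = 0 -> exists c, b = y * c
}.

Section IdealYY.
Variables (k : fieldType) (F : pzRingType) (W : word_algebra k 'I_2 F).
Local Notation mono := (mono W).
Local Notation wcoef := (wcoef W).
Local Notation lderiv := (lderiv W).
Local Notation wcomp := (wcomp W).
Local Notation wdeg := (wdeg W).
Local Notation X := (letter W 0).
Local Notation Y := (letter W 1).
Local Notation J := (ideal_gen (Y ^+ 2)).
Implicit Types (c d : k) (u v z : F).

Lemma ideal_ind (P : F -> Prop) : P 0 ->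
  (forall u v, P u -> P v -> P (u + v)) -> (forall p q, P (p * Y ^+ 2 * q)) ->
  forall z, z \in J -> P z.
Proof.
move=> P0 PD Pm z /asboolP[s ->].
by apply: big_ind => // i _; apply: Pm.
Qed.

Lemma ideal_sq z : Y ^+ 2 * z \in J.
Proof. by apply/asboolP; exists [:: (1, z)]; rewrite big_seq1 mul1r. Qed.

Lemma word_decomp2 u :
  u = wscalar W (wcoef [::] u) + X * lderiv 0 u + Y * lderiv 1 u.
Proof.
rewrite {1}(word_decomp W u) big_ord_recl big_ord1 addrA.
by rewrite (_ : lift _ _ = 1 :> 'I_2) //; apply: val_inj.
Qed.

(** The derivative along x preserves the ideal (y^2), the one along y preserves
it up to multiples of y: both are read off from the decomposition of
p y^2 q by the first letters of p, where the constant part c of p contributes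
c y y q, with derivative y (c q). This transports the decomposition by first
letters from the free algebra to B. *)
Lemma ideal_lderiv z : z \in J ->
  [/\ wcoef [::] z = 0, lderiv 0 z \in J & exists t, lderiv 1 z - Y * t \in J].
Proof.
move: z; apply: ideal_ind.
- by rewrite wcoef0 !lderiv0 rpred0; split=> //; exists 0; rewrite mulr0 subr0 rpred0.
- move=> u v [u1 u2 [t u3]] [v1 v2 [t' v3]].
  rewrite wcoefD u1 v1 addr0 !lderivD rpredD //; split=> //.
  by exists (t + t'); rewrite mulrDr opprD addrACA rpredD.
move=> p q; set c := wcoef [::] p; set a := lderiv 0 p; set b := lderiv 1 p.
have -> : p * Y ^+ 2 * q =
    wscalar W c * (Y * (Y * q)) + X * (a * Y ^+ 2 * q) + Y * (b * Y ^+ 2 * q).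
  by rewrite {1}(word_decomp2 p) !mulrDl -/a -/b -/c expr2 -!mulrA.
have J2 r : r * Y ^+ 2 * q \in J by rewrite -mulrA; apply/ideal_genMl/ideal_sq.
rewrite !lderivD !lderivC !lderiv_letter /= mulr0 addr0 add0r.
split=> //; last first.
  exists (wscalar W c * q).
  have -> : Y * (wscalar W c * q) = wscalar W c * (Y * q).
    by rewrite mulrA -wscalarC mulrA.
  by rewrite addr0 addrAC subrr add0r.
have coefL i u : wcoef [::] (letter W i * u) = 0.
  move: u; apply: (word_ind (W := W)) => [d w|u v IHu IHv].
    by rewrite letter_mono wcoefU.
  by rewrite mulrDr wcoefD IHu IHv addr0.
by rewrite mulrA wscalarC -mulrA !wcoefD !coefL !addr0.
Qed.

(** The ideal is spanned by words that contain yy, so it is homogeneous. *)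
Lemma ideal_wcomp n z : z \in J -> wcomp n z \in J.
Proof.
move: z; apply: ideal_ind => [|u v uJ vJ|p q]; first by rewrite wcomp0 rpred0.
  by rewrite wcompD rpredD.
have JP p' q' : p' * Y ^+ 2 * q' \in J.
  by rewrite -mulrA; apply/ideal_genMl/ideal_sq.
move: p q; apply: (word_ind (W := W)) => [c w|u v IHu IHv]; last first.
  by move=> q; rewrite !mulrDl wcompD rpredD.
apply: (word_ind (W := W)) => [d v|u v IHu IHv]; last by rewrite mulrDr wcompD rpredD.
have := JP (mono c w) (mono d v); rewrite expr2 !monoM wcomp_mono.
by case: ifP => // _ _; apply: rpred0.
Qed.

Lemma wdegP n u : wdeg n u <-> wcomp n u = u.
Proof.
split=> [un|<- w]; last first.
  by rewrite wcoef_wcomp; case: (_ =P n); rewrite ?eqxx.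
apply/eqP; rewrite -subr_eq0; apply/eqP/(wcoef_ext (W := W)) => w.
rewrite wcoefD wcoefN wcoef_wcomp.
case: (altP (wcoef w u =P 0)) => [->|/un ->]; last by rewrite eqxx subrr.
by rewrite subr0; case: ifP.
Qed.

Local Notation B := (pquot (Y ^+ 2)).
Let pi u : B := \pi_B u.

Let piD u v : pi (u + v) = pi u + pi v.
Proof. exact: pquot_addE. Qed.

Let piM u v : pi (u * v) = pi u * pi v.
Proof. by symmetry; apply: pquot_mulE. Qed.

Let pi_eq u v : pi u = pi v <-> u - v \in J.
Proof. by rewrite -pquot_eqE; split=> /eqP. Qed.

Let pi0 : pi 0 = 0.
Proof. exact: morph_add0 piD. Qed.

Let piN u : pi (- u) = - pi u.
Proof. exact: morph_addN piD u. Qed.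

Let pi_eq0 u : pi u = 0 <-> u \in J.
Proof. by rewrite -pi0 pi_eq subr0. Qed.

Let piP (b : B) : exists u, b = pi u.
Proof. by exists (repr b); rewrite /pi reprK. Qed.

Definition quot_deg (i : int) (b : B) : Prop := exists u, wdeg i u /\ b = \pi_B u.

Lemma quot_grading : is_grading quot_deg.
Proof.
pose pr n (b : B) : B := pi (wcomp n (repr b)).
have prE n u : pr n (pi u) = pi (wcomp n u).
  apply/pi_eq; rewrite -wcompN -wcompD; apply: ideal_wcomp.
  by apply/pi_eq; rewrite /pi reprK.
have ww n m u : wcomp m (wcomp n u) = if n == m then wcomp n u else 0.
  move: u; apply: (word_ind (W := W)) => [c w|u v IHu IHv].
    rewrite wcomp_mono; case: eqP => [<-|_]; first by rewrite wcomp_mono.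
    by rewrite wcomp0; case: ifP.
  by rewrite !wcompD IHu IHv; case: ifP; rewrite ?addr0.
apply: (@components_grading _ _ pr); split.
- move=> i b c; have [u ->] := piP b; have [v ->] := piP c.
  by rewrite -piN -piD !prE wcompD wcompN piD piN.
- move=> i b; have [u ->] := piP b; rewrite prE.
  by exists (wcomp i u); split=> //; apply/wdegP; rewrite ww eqxx.
- move=> i j b [u [/wdegP <- ->]].
  by rewrite -/(pi _) prE ww; case: ifP.
move=> b; have [u ->] := piP b.
pose s := undup [seq (size w)%:Z | w <- supp W u].
exists s; first exact: undup_uniq.
rewrite (eq_bigr (fun i => pi (wcomp i u))) => [|i _]; last exact: prE.
rewrite -(big_morph pi piD pi0); congr pi.
apply/eqP; rewrite -subr_eq0; apply/eqP/(wcoef_ext (W := W)) => w.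
rewrite wcoefD wcoefN (big_morph (wcoef w) (wcoefD W w) (wcoef0 W w)).
have [ws|/wcoef_supp ws] := boolP (w \in supp W u); last first.
  by rewrite ws big1 ?subrr // => i _; rewrite wcoef_wcomp ws; case: ifP.
rewrite (bigD1_seq ((size w)%:Z)) /= ?undup_uniq ?mem_undup ?map_f //.
rewrite wcoef_wcomp eqxx big1 ?addr0 ?subrr // => i.
by rewrite wcoef_wcomp eq_sym => /negPf ->.
Qed.

(** An equation in B is a membership in (y^2), to which the left derivatives are
applied: from x u + y v in the ideal, the derivative along x gives that u is in
it; from y u in the ideal, the one along y gives that u is in y F + (y^2). *)
Lemma penrose_quot :
  penrose_algebra (fun c => pi (wscalar W c)) quot_deg (pi X) (pi Y).
Proof.
have scM c d : wscalar W (c * d) = wscalar W c * wscalar W d by rewrite wscalar_mono.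
have deg_mono c w : wdeg (size w)%:Z (mono c w).
  by apply/wdegP; rewrite wcomp_mono eqxx.
have degD n u v : wdeg n u -> wdeg n v -> wdeg n (u + v).
  by move=> /wdegP un /wdegP vn; apply/wdegP; rewrite wcompD un vn.
have deg0 n : wdeg n 0 by move=> w; rewrite wcoef0 eqxx.
have deg_sum n (P : F -> Prop) : P 0 -> (forall u v, P u -> P v -> P (u + v)) ->
    (forall c w, (size w)%:Z = n -> P (mono c w)) -> forall u, wdeg n u -> P u.
  move=> P0 PD Pm u un; rewrite (supp_sum W u); apply: big_ind => // w _.
  have [->|] := altP (wcoef w u =P 0); first by rewrite mono0.
  by move=> /un /Pm.
split.
- by rewrite /wscalar mono1.
- by move=> c d; rewrite /wscalar monoD piD.
- by move=> c d; rewrite scM piM.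
- move=> c /pi_eq0 /ideal_lderiv[]; rewrite /wscalar wcoefU eqxx //.
- by move=> c b; have [u ->] := piP b; rewrite -!piM wscalarC.
- exact: quot_grading.
- move=> i j _ _ [u [ui ->]] [v [vj ->]]; exists (u * v).
  rewrite -!/(pi _) piM; split=> //.
  move: u ui; apply: (deg_sum _); first by rewrite mul0r.
    by move=> a b; rewrite mulrDl; apply: degD.
  move=> c w wi; move: v vj; apply: (deg_sum _); first by rewrite mulr0.
    by move=> a b; rewrite mulrDr; apply: degD.
  by move=> d w' wj; rewrite monoM -wi -wj -PoszD -size_cat; apply: deg_mono.
- move=> n _ [u [un ->]]; apply/pi_eq0; suff -> : u = 0 by apply: rpred0.
  by apply: (wcoef_ext (W := W)) => w; apply/eqP; apply: contraT => /un.
- move=> a; split=> [[u [un ->]]|[c ->]]; last first.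
    by exists (wscalar W c); split=> //; apply: deg_mono c [::].
  move: u un; apply: (deg_sum _) => [|v w [c vc] [d wd]|c [|//] _].
  + by exists 0; rewrite /wscalar mono0.
  + by exists (c + d); rewrite -/(pi _) piD /wscalar monoD piD; congr (_ + _).
  by exists c.
- by exists X; split=> //; apply: deg_mono 1 [:: _].
- by exists Y; split=> //; apply: deg_mono 1 [:: _].
- move=> n _ [u [un ->]].
  move: u un; apply: (deg_sum _).
  + by exists 0, 0; rewrite !mulr0 addr0 -pi0; split=> //; exists 0.
  + move=> v w [a [b [[a' [a1 ->]] [b' [b1 ->]] vE]]].
    move=> [c [d [[c' [c1 ->]] [d' [d1 ->]] wE]]].
    exists (pi (a' + c')), (pi (b' + d')); split.
    * by exists (a' + c'); split=> //; apply: degD.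
    * by exists (b' + d'); split=> //; apply: degD.
    by rewrite -/(pi _) piD [pi v]vE [pi w]wE !piD !mulrDr addrACA.
  move=> c [|i w] //= [<-].
  have [->|->] : i = 0 \/ i = 1.
  + by case: i => [[|[|//]] jP]; [left|right]; apply: val_inj.
  + exists (pi (mono c w)), (pi 0); split.
    * by exists (mono c w).
    * by exists 0.
    by rewrite -!/(pi _) -letter_mono -!piM mulr0 pi0 addr0.
  exists (pi 0), (pi (mono c w)); split.
  + by exists 0.
  + by exists (mono c w).
  by rewrite -!/(pi _) -letter_mono -!piM mulr0 pi0 add0r.
- move=> b c; have [u ->] := piP b; have [v ->] := piP c.
  rewrite -!piM -piD => /pi_eq0 uv.
  have uJ : u \in J.
    have [_ + _] := ideal_lderiv uv.
    by rewrite lderivD !lderiv_letter /= addr0.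
  split; first exact/pi_eq0.
  apply/pi_eq0; rewrite -[Y * v](addKr (X * u)) addrC rpredB //.
  exact: ideal_genMl.
- by rewrite -piM -expr2; apply/pi_eq0; have := ideal_sq 1; rewrite mulr1.
move=> b; have [u ->] := piP b; rewrite -piM => /pi_eq0 /ideal_lderiv[_ _ [t]].
rewrite lderiv_letter /= => tJ; exists (pi t); rewrite -piM.
exact/pi_eq.
Qed.

End IdealYY.
(** * The free algebra as an algebra of words *)

Section FreeAlgebra.
Variable k : fieldType.

(** The constructor is the locked one, so that the letters of the word algebra
are convertible to the generators of [free2]. *)
Definition fmonom_of_word (w : seq 'I_2) : {fmonom 'I_2} :=
  fmonom_of_seq fmonom_key w.

Lemma fmonom_of_wordK (m : {fmonom 'I_2}) : fmonom_of_word (fmonom_val m) = m.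
Proof. by rewrite /fmonom_of_word fmE fmK. Qed.

Lemma fmonom_of_word_inj : injective fmonom_of_word.
Proof. by move=> v w; rewrite /fmonom_of_word !fmE => -[]. Qed.

Lemma fmonom_of_cat v w :
  mmul (fmonom_of_word v) (fmonom_of_word w) = fmonom_of_word (v ++ w).
Proof.
by rewrite /fmonom_of_word !fmE; exact: fmmulE.
Qed.

Definition free2_words : word_algebra k 'I_2 (free2 k).
Proof.
refine (@WordAlgebra k 'I_2 (free2 k)
  (fun c w => << c *g fmonom_of_word w >>) (fun w u => u@_(fmonom_of_word w))
  (fun u => [seq fmonom_val m | m <- msupp u]) _ _ _ _ _ _ _ _).
- by move=> c d w; apply: monalgUD.
- move=> c d v w; rewrite -fmonom_of_cat; exact: fgmulUU.
- by [].
- by move=> w u v; apply: mcoeffD.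
- move=> c v w; rewrite mcoeffU (inj_eq fmonom_of_word_inj).
  by case: eqP.
- move=> u; rewrite map_inj_uniq ?fset_uniq // => m m' e.
  by rewrite -(fmonom_of_wordK m) e fmonom_of_wordK.
- move=> u w wu; apply: mcoeff_outdom; apply: contra wu => wu.
  by apply/mapP; exists (fmonom_of_word w); rewrite // /fmonom_of_word fmE.
move=> u; rewrite big_map.
etransitivity; first exact: monalgE.
apply: eq_bigr => m _; by rewrite fmonom_of_wordK.
Defined.

Lemma B_degE i (b : B k) : B_deg i b <-> quot_deg (W := free2_words) i b.
Proof.
split=> [] [u [un bE]]; exists u; split=> //.
  by move=> w wu; rewrite -(un _ wu) /fmonom_of_word fmE.
by move=> m; rewrite -(fmonom_of_wordK m) => /un <-; rewrite fmonom_of_wordK.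
Qed.

Lemma penrose_B : penrose_algebra (@B_scalar k) (@B_deg k)
  (B_pi (free_x k)) (B_pi (free_y k)).
Proof.
have -> : @B_deg k = quot_deg (W := free2_words).
  by apply/funext => i; apply/funext => b; apply/propext/B_degE.
exact: (@penrose_quot k (free2 k) free2_words).
Qed.

End FreeAlgebra.
(** * Graded modules: free modules and quotients *)

Section GradedModules.
Variables (A : pzRingType) (A_ : int -> A -> Prop).

Record graded_ring : Prop := GradedRing {
  gr_grading : is_grading A_;
  gr_mul : forall i j a b, A_ i a -> A_ j b -> A_ (i + j) (a * b);
  gr_one : A_ 0 1
}.

Hypothesis gA : graded_ring.

Definition acomp : int -> A -> A := sval (cid (grading_components (gr_grading gA))).
Definition gcomp (M : grmod A_) : int -> M -> M :=
  sval (cid (grading_components (gm_grading M))).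

Lemma acompP : components A_ acomp.
Proof. exact: (svalP (cid (grading_components (gr_grading gA)))). Qed.

Lemma gcompP (M : grmod A_) : components (@gm_deg _ _ M) (@gcomp M).
Proof. exact: (svalP (cid (grading_components (gm_grading M)))). Qed.

Section Comp.
Variables (V : zmodType) (V_ : int -> V -> Prop) (pr : int -> V -> V).
Hypothesis prP : components V_ pr.

Lemma comp_deg i v : V_ i (pr i v).
Proof. by have [_ prV _ _] := prP; apply: prV. Qed.

Lemma comp0 i : pr i 0 = 0.
Proof. by have [prB _ _ _] := prP; have := prB i 0 0; rewrite !subrr. Qed.

Lemma compN i v : pr i (- v) = - pr i v.
Proof. by have [prB _ _ _] := prP; rewrite -sub0r prB comp0 sub0r. Qed.

Lemma compD i u v : pr i (u + v) = pr i u + pr i v.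
Proof. by have [prB _ _ _] := prP; rewrite -{1}(opprK v) prB compN opprK. Qed.

Lemma comp_sum (T : Type) (s : seq T) (P : pred T) f i :
  pr i (\sum_(t <- s | P t) f t) = \sum_(t <- s | P t) pr i (f t).
Proof. exact: (big_morph (pr i) (compD i) (comp0 i)). Qed.

Lemma comp_hom i j v : V_ i v -> pr j v = if i == j then v else 0.
Proof. by have [_ _ prE _] := prP; apply: prE. Qed.

Lemma comp_id i v : V_ i v -> pr i v = v.
Proof. by move=> /(comp_hom i); rewrite eqxx. Qed.

Lemma comp_eq0 v : (forall i, pr i v = 0) -> v = 0.
Proof.
by have [_ _ _ /(_ v)[s _ vE]] := prP; move=> v0; rewrite vE big1.
Qed.

Lemma deg0 i : V_ i 0.
Proof. by rewrite -(comp0 i); apply: comp_deg. Qed.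

Lemma degN i v : V_ i v -> V_ i (- v).
Proof. by move=> /comp_id <-; rewrite -compN; apply: comp_deg. Qed.

Lemma degD i u v : V_ i u -> V_ i v -> V_ i (u + v).
Proof. by move=> /comp_id <- /comp_id <-; rewrite -compD; apply: comp_deg. Qed.

Lemma degB i u v : V_ i u -> V_ i v -> V_ i (u - v).
Proof. by move=> ui vi; apply/degD/degN. Qed.

Lemma deg_sum (T : Type) (s : seq T) (P : pred T) f i :
  (forall t, P t -> V_ i (f t)) -> V_ i (\sum_(t <- s | P t) f t).
Proof. by move=> fi; apply: big_ind => //; [apply: deg0 | apply: degD]. Qed.

Lemma comp_ind (P : V -> Prop) : P 0 -> (forall u v, P u -> P v -> P (u + v)) ->
  (forall i v, V_ i v -> P v) -> forall v, P v.
Proof.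
move=> P0 PD Ph v; have [_ _ _ /(_ v)[s _ ->]] := prP.
by apply: big_ind => // i _; apply: Ph (comp_deg i v).
Qed.
End Comp.

Lemma gcompZr (M : grmod A_) i j a (m : M) :
  gm_deg j m -> gcomp i (a *: m) = acomp (i - j) a *: m.
Proof.
move=> mj; move: a; apply: (comp_ind acompP).
- by rewrite scale0r (comp0 acompP) scale0r (comp0 (@gcompP M)).
- by move=> a b IHa IHb; rewrite scalerDl (compD (@gcompP M)) IHa IHb
    (compD acompP) scalerDl.
move=> l a al; rewrite (comp_hom acompP _ al).
rewrite (comp_hom (@gcompP M) i (gm_scale al mj)).
by rewrite [l == _]eq_sym subr_eq eq_sym; case: ifP; rewrite ?scale0r.
Qed.

Lemma gcompZl (M : grmod A_) i j a (m : M) :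
  A_ j a -> gcomp i (a *: m) = a *: gcomp (i - j) m.
Proof.
move=> aj; move: m; apply: (comp_ind (@gcompP M)).
- by rewrite scaler0 !(comp0 (@gcompP M)) scaler0.
- by move=> u v IHu IHv; rewrite scalerDr !(compD (@gcompP M)) IHu IHv scalerDr.
move=> l m ml; rewrite (comp_hom (@gcompP M) i (gm_scale aj ml)).
rewrite (comp_hom (@gcompP M) (i - j) ml) [l == _]eq_sym subr_eq eq_sym addrC.
by case: ifP; rewrite ?scaler0.
Qed.

Lemma acompM i j a b : A_ j b -> acomp i (a * b) = acomp (i - j) a * b.
Proof.
move=> bj; move: a; apply: (comp_ind acompP).
- by rewrite mul0r (comp0 acompP) mul0r (comp0 acompP).
- by move=> a c IHa IHc; rewrite mulrDl !(compD acompP) IHa IHc mulrDl.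
move=> l a al; rewrite (comp_hom acompP _ al).
rewrite (comp_hom acompP i (gr_mul gA al bj)).
by rewrite [l == _]eq_sym subr_eq eq_sym; case: ifP; rewrite ?mul0r.
Qed.

(** ** Free modules *)

Section Free.
Variables (n : nat) (d : 'I_n -> int).

Definition free_deg (i : int) (r : 'rV[A]_n) : Prop :=
  forall j, A_ (i - d j) (r 0 j).

Lemma free_grading : is_grading free_deg.
Proof.
have aP := acompP.
pose pr i (r : 'rV[A]_n) : 'rV[A]_n := \row_j acomp (i - d j) (r 0 j).
apply: (@components_grading _ _ pr).
split=> [i u v|i v j|i i' v vi|v].
- by apply/rowP => j; rewrite !mxE (compD aP) (compN aP).
- by rewrite mxE; apply: comp_deg aP _ _.
- apply/rowP => j; rewrite mxE (comp_hom aP _ (vi j)).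
  by rewrite (inj_eq (addIr _)); case: ifP; rewrite ?mxE.
have /choice[s sP] : forall j, exists s, uniq s /\
    v 0 j = \sum_(i <- s) acomp i (v 0 j).
  by move=> j; have [_ _ _ /(_ (v 0 j))[s us vE]] := aP; exists s.
have sout j i : i \notin s j -> acomp i (v 0 j) = 0.
  have [us vE] := sP j => i_s; rewrite vE (comp_sum aP).
  rewrite big_seq big1 // => l ls; rewrite (comp_hom aP i (comp_deg aP l _)).
  by case: eqP => // li; rewrite -li ls in i_s.
pose t := undup (flatten [seq [seq i + d j | i <- s j] | j <- enum 'I_n]).
exists t; first exact: undup_uniq.
apply/rowP => j; rewrite summxE.
have [us {1}->] := sP j.
rewrite [RHS](eq_bigr (fun i => acomp (i - d j) (v 0 j))); last first.
  by move=> i _; rewrite mxE.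
rewrite -[RHS](big_map (fun i => i - d j) predT (fun i => acomp i (v 0 j))).
apply: sum_widen => //.
- by rewrite map_inj_uniq ?undup_uniq //; apply: addIr.
- move=> i i_s; apply/mapP; exists (i + d j); last by rewrite addrK.
  rewrite mem_undup; apply/flattenP; exists [seq i + d j | i <- s j].
    by apply/mapP; exists j; rewrite ?mem_enum.
  exact: map_f.
exact: sout.
Qed.

Lemma free_scale i j a r : A_ i a -> free_deg j r -> free_deg (i + j) (a *: r).
Proof.
by move=> ai rj l; rewrite mxE -addrA; apply: gr_mul.
Qed.

Lemma free_fin_pres : graded_fin_pres A_ free_deg.
Proof.
exists n, d, (fun j => delta_mx 0 j), 0%N, (fun=> 0), (fun _ _ => 0).
split=> [j l|[]//|m|c].
- rewrite mxE /=; case: eqP => [->|_]; last exact: (deg0 acompP).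
  by rewrite subrr; apply: gr_one.
- by exists (m 0); apply: row_sum_delta.
split=> [c0|[a cE]].
  exists (fun=> 0) => j; rewrite big_ord0.
  have := congr1 (fun r : 'rV_n => r 0 j) c0; rewrite summxE mxE => <-.
  rewrite (bigD1 j) //= big1 ?addr0 => [|l lj]; rewrite !mxE !eqxx ?mulr1 //=.
  by rewrite eq_sym (negPf lj) mulr0.
by rewrite big1 // => j _; rewrite cE big_ord0 scale0r.
Qed.

Definition free_grmod : grmod A_ := GrMod free_grading free_scale free_fin_pres.

Section FreeHom.
Variables (M : grmod A_) (x : 'I_n -> M).

Definition free_fun (r : 'rV[A]_n) : M := \sum_j r 0 j *: x j.

Lemma free_fun_linear : linear free_fun.
Proof.
move=> a u v; rewrite /free_fun scaler_sumr -big_split.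
by apply: eq_bigr => j _; rewrite !mxE scalerDl scalerA.
Qed.
HB.instance Definition _ :=
  GRing.isLinear.Build A 'rV[A]_n M *:%R free_fun free_fun_linear.

Hypothesis xd : forall j, gm_deg (d j) (x j).

Lemma free_fun_deg i r : free_deg i r -> gm_deg i (free_fun r).
Proof.
move=> ri; apply: (deg_sum (@gcompP M)) => j _.
by rewrite -(subrK (d j) i); apply: gm_scale (ri j) (xd j).
Qed.

Definition free_hom : grhom free_grmod M :=
  @GrHom _ _ free_grmod M (free_fun : {linear 'rV[A]_n -> M}) free_fun_deg.
End FreeHom.

End Free.

End GradedModules.
(** ** Quotients by finitely generated graded submodules *)

Section LmodQuotient.
Variables (A : pzRingType) (M : lmodType A) (q : nat) (u : 'I_q -> M).

Definition span_pred : {pred M} := fun m =>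
  `[< exists a : 'I_q -> A, m = \sum_i a i *: u i >].

Lemma spanP m : reflect (exists a : 'I_q -> A, m = \sum_i a i *: u i)
  (m \in span_pred).
Proof. exact: asboolP. Qed.

Fact span_zmod : zmod_closed span_pred.
Proof.
split=> [|m m' /spanP[a ->] /spanP[b ->]]; apply/spanP.
  by exists (fun=> 0); rewrite big1 // => i _; rewrite scale0r.
exists (fun i => a i - b i); rewrite -sumrB.
by apply: eq_bigr => i _; rewrite scalerBl.
Qed.
HB.instance Definition _ := GRing.isZmodClosed.Build M span_pred span_zmod.

Lemma spanZ a m : m \in span_pred -> a *: m \in span_pred.
Proof.
move=> /spanP[b ->]; apply/spanP; exists (fun i => a * b i).
by rewrite scaler_sumr; apply: eq_bigr => i _; rewrite scalerA.
Qed.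

Definition lquot : Type := Quotient.quot span_pred.
HB.instance Definition _ := GRing.Zmodule.on lquot.

Definition lpi (m : M) : lquot := \pi_lquot m.

Lemma lpi_eq m m' : lpi m = lpi m' <-> m - m' \in span_pred.
Proof.
have E : (lpi m == lpi m') = (m - m' \in span_pred).
  by rewrite /lpi piE Quotient.equivE.
by rewrite -E; split=> /eqP.
Qed.

Lemma lpiD m m' : lpi (m + m') = lpi m + lpi m'.
Proof. by rewrite /lpi !piE. Qed.

Lemma lpiP (v : lquot) : exists m, v = lpi m.
Proof. by exists (repr v); rewrite /lpi reprK. Qed.

Definition lscale (a : A) (v : lquot) : lquot := lpi (a *: repr v).

Lemma lscaleE a m : lscale a (lpi m) = lpi (a *: m).
Proof.
apply/lpi_eq; rewrite -scalerBr; apply: spanZ.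
by apply/lpi_eq; rewrite /lpi reprK.
Qed.

Fact lscaleA a b v : lscale a (lscale b v) = lscale (a * b) v.
Proof. by have [m ->] := lpiP v; rewrite !lscaleE scalerA. Qed.

Fact lscale1 : left_id 1 lscale.
Proof. by move=> v; have [m ->] := lpiP v; rewrite lscaleE scale1r. Qed.

Fact lscaleDr : right_distributive lscale +%R.
Proof.
move=> a v w; have [m ->] := lpiP v; have [m' ->] := lpiP w.
by rewrite -lpiD !lscaleE -lpiD scalerDr.
Qed.

Fact lscaleDl v : {morph lscale^~ v : a b / a + b}.
Proof.
by move=> a b; have [m ->] := lpiP v; rewrite !lscaleE scalerDl lpiD.
Qed.

HB.instance Definition _ :=
  GRing.Zmodule_isLmodule.Build A lquot lscaleA lscale1 lscaleDr lscaleDl.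

Lemma lpi_linear : linear lpi.
Proof. by move=> a m m'; rewrite lpiD -lscaleE. Qed.
HB.instance Definition _ := GRing.isLinear.Build A M lquot *:%R lpi lpi_linear.

Section Factor.
Variables (N : lmodType A) (f : {linear M -> N}).
Hypothesis fu : forall i, f (u i) = 0.

Definition lfactor (v : lquot) : N := f (repr v).

Lemma lfactorE m : lfactor (lpi m) = f m.
Proof.
apply/eqP; rewrite -subr_eq0 -linearB.
have /lpi_eq/spanP[a ->] : lpi (repr (lpi m)) = lpi m by rewrite /lpi reprK.
by rewrite linear_sum big1 // => i _; rewrite linearZ /= fu scaler0.
Qed.

Lemma lfactor_linear : linear lfactor.
Proof.
move=> a v w; have [m ->] := lpiP v; have [m' ->] := lpiP w.
by rewrite -linearP !lfactorE linearP.
Qed.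

Definition lfactor_hom : {linear lquot -> N} := HB.pack lfactor
  (GRing.isLinear.Build A lquot N *:%R lfactor lfactor_linear).
End Factor.

End LmodQuotient.

Section GradedQuotient.
Variables (A : pzRingType) (A_ : int -> A -> Prop).
Hypothesis gA : graded_ring A_.
Variables (M : grmod A_) (q : nat) (e : 'I_q -> int) (u : 'I_q -> M).
Hypothesis ue : forall i, gm_deg (e i) (u i).

Local Notation Q := (lquot u).

Definition quot_mdeg (i : int) (v : Q) : Prop :=
  exists2 m, gm_deg i m & v = lpi u m.

Lemma span_comp i m : m \in span_pred u -> gcomp i m \in span_pred u.
Proof.
move=> /spanP[a ->]; apply/spanP; exists (fun l => acomp gA (i - e l) (a l)).
rewrite (comp_sum (gcompP M)); apply: eq_bigr => l _.
exact: gcompZr.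
Qed.

Lemma quot_mgrading : is_grading quot_mdeg.
Proof.
have mP := gcompP M.
pose pr i (v : Q) : Q := lpi u (gcomp i (repr v)).
have prE i m : pr i (lpi u m) = lpi u (gcomp i m).
  apply/lpi_eq; rewrite -(compN mP) -(compD mP); apply: span_comp.
  by apply/lpi_eq; rewrite /lpi reprK.
apply: (@components_grading _ _ pr); split=> [i v w|i v|i j _ [m mi ->]|v].
- have [m ->] := lpiP v; have [m' ->] := lpiP w.
  by rewrite -linearB !prE (compD mP) (compN mP) linearB.
- by have [m ->] := lpiP v; rewrite prE; exists (gcomp i m) => //; apply: comp_deg.
- by rewrite prE (comp_hom mP j mi); case: ifP; rewrite ?linear0.
have [m ->] := lpiP v; have [_ _ _ /(_ m)[s us mE]] := mP.
exists s => //; rewrite {1}mE linear_sum.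
by apply: eq_bigr => i _; rewrite prE.
Qed.

Lemma quot_mscale i j a v : A_ i a -> quot_mdeg j v -> quot_mdeg (i + j) (a *: v).
Proof.
by move=> ai [m mj ->]; exists (a *: m); rewrite ?linearZ //; apply: gm_scale.
Qed.

(** The coordinates of a homogeneous element on homogeneous generators may be
taken homogeneous, by keeping only the components of the right degree. *)
Lemma hom_coord n (d : 'I_n -> int) (x : 'I_n -> M) i m (c : 'I_n -> A) :
  (forall j, gm_deg (d j) (x j)) -> gm_deg i m -> m = \sum_j c j *: x j ->
  m = \sum_j acomp gA (i - d j) (c j) *: x j.
Proof.
move=> xd mi mE; rewrite -{1}(comp_id (gcompP M) mi) {1}mE.
rewrite (comp_sum (gcompP M)); apply: eq_bigr => j _.
exact: gcompZr.
Qed.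

(** A presentation of the quotient: the generators of [M], the relations of [M],
and the coordinates of the elements [u i] as new relations. *)
Lemma quot_mfin_pres : graded_fin_pres A_ quot_mdeg.
Proof.
have [n [d [x [p [f [r [xd rd xgen xrel]]]]]]] := gm_fin_pres M.
have /choice[c cP] : forall i, exists c : 'I_n -> A,
    (forall j, A_ (e i - d j) (c j)) /\ u i = \sum_j c j *: x j.
  move=> i; have [c uE] := xgen (u i).
  exists (fun j => acomp gA (e i - d j) (c j)); split.
    by move=> j; apply: comp_deg (acompP gA) _ _.
  exact: hom_coord (ue i) uE.
exists n, d, (fun j => lpi u (x j)), (p + q)%N.
exists (fun l => match split l with inl l => f l | inr i => e i end).
exists (fun l => match split l with inl l => r l | inr i => c i end).
split=> [j|l j|v|b].
- by exists (x j).
- by case: split => l'; [apply: rd | have [cd _] := cP l'; apply: cd].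
- have [m ->] := lpiP v; have [b ->] := xgen m; exists b.
  by rewrite linear_sum; apply: eq_bigr => j _; rewrite linearZ.
have -> : \sum_j b j *: lpi u (x j) = lpi u (\sum_j b j *: x j).
  by rewrite linear_sum; apply: eq_bigr => j _; rewrite linearZ.
have sumE (a : 'I_(p + q) -> A) j :
    \sum_l a l * (match split l with inl l => r l | inr i => c i end) j =
    \sum_l a (lshift q l) * r l j + \sum_i a (rshift p i) * c i j.
  rewrite big_split_ord /=; congr (_ + _); apply: eq_bigr => l _.
    by rewrite (unsplitK (inl l)).
  by rewrite (unsplitK (inr l)).
have combE (a : 'I_q -> A) : \sum_i a i *: u i = \sum_j (\sum_i a i * c i j) *: x j.
  under [RHS]eq_bigr do rewrite scaler_suml.
  rewrite exchange_big; apply: eq_bigr => i _.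
  have [_ ->] := cP i; rewrite scaler_sumr.
  by apply: eq_bigr => j _; rewrite scalerA.
rewrite -(linear0 (lpi u)) lpi_eq subr0; split=> [/spanP[a bE]|[a bE]].
  have : \sum_j (b j - \sum_i a i * c i j) *: x j = 0.
    under eq_bigr do rewrite scalerBl.
    by rewrite sumrB -combE bE subrr.
  move=> /xrel[a' a'E].
  exists (fun l => match split l with inl l => a' l | inr i => a i end) => j.
  rewrite sumE; under eq_bigr do rewrite (unsplitK (inl _)).
  under [X in _ + X]eq_bigr do rewrite (unsplitK (inr _)).
  by rewrite -a'E subrK.
apply/spanP; exists (fun i => a (rshift p i)); rewrite combE.
apply/eqP; rewrite -subr_eq0 -sumrB; apply/eqP.
under eq_bigr do rewrite -scalerBl.
apply/xrel; exists (fun l => a (lshift q l)) => j.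
by rewrite bE sumE addrK.
Qed.

Definition quotm : grmod A_ := GrMod quot_mgrading quot_mscale quot_mfin_pres.

Definition quotm_pi : grhom M quotm :=
  @GrHom _ _ M quotm (lpi u : {linear M -> Q}) (fun i m mi => ex_intro2 _ _ m mi erefl).

End GradedQuotient.
(** * Injections with finite dimensional cokernel are inverted in the quotient *)

Section SerreIso.
Variables (k : fieldType) (A : pzRingType) (sc : k -> A) (A_ : int -> A -> Prop).
Hypothesis gA : graded_ring A_.
Implicit Types M N Z : grmod A_.
Local Notation C := (gr A_).

Lemma zero_hom_deg M N i (m : M) :
  gm_deg i m -> gm_deg i ((\0 : {linear M -> N}) m).
Proof. by move=> _; apply: deg0 (gcompP N) i. Qed.

Definition zero_hom M N : grhom M N := GrHom (@zero_hom_deg M N).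

(** The identity of a zero object is also its zero map. *)
Lemma zero_objE Z : zero_obj (Z : C) <-> forall z : Z, z = 0.
Proof.
split=> [/(_ Z)[[f fE] _] z|Z0 M].
  by rewrite -[z]/(idm (Z : C) z) (fE (idm (Z : C)) z) -(fE (zero_hom Z Z) z).
split; [exists (zero_hom M Z) | exists (zero_hom Z M)] => f m.
  exact: Z0.
by rewrite (Z0 m) !linear0.
Qed.

Definition zero_mod : grmod A_ := free_grmod gA (fun _ : 'I_0 => 0).

Lemma zero_mod0 : zero_obj (zero_mod : C).
Proof. by apply/zero_objE => z; apply/rowP => -[]. Qed.

Lemma zero_morE M N (f : Defs.hom (M : C) N) :
  zero_mor f <-> forall m : M, f m = 0.
Proof.
split=> [[Z [g [h [/zero_objE Z0 fE]]]] m|f0].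
  by rewrite (fE m) /= (Z0 (g m)) linear0.
exists zero_mod, (zero_hom M zero_mod), (zero_hom zero_mod N).
by split=> [|m]; [apply: zero_mod0 | apply: f0].
Qed.

Section Quotient.
Variables (M : grmod A_) (n : nat) (d : 'I_n -> int) (u : 'I_n -> M).
Hypothesis ud : forall j, gm_deg (d j) (u j).
Let i := free_hom gA ud.

Lemma free_hom_kernel : (forall r, i r = 0 -> r = 0) ->
  is_kernel (i : Defs.hom (free_grmod gA d : C) M) (zero_hom zero_mod (free_grmod gA d)).
Proof.
move=> i0; split=> [|N g /zero_morE ig].
  by apply/zero_morE => m /=; rewrite linear0.
have g0 m : g m = 0 by apply: i0; apply: ig.
exists (zero_hom N zero_mod); split=> [m|h _ m]; first by rewrite g0.
by have /zero_objE := zero_mod0; apply.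
Qed.

Lemma free_hom_cokernel :
  is_cokernel (i : Defs.hom (free_grmod gA d : C) M) (quotm_pi gA ud).
Proof.
split=> [|N g /zero_morE gi].
  apply/zero_morE => r /=; rewrite -(linear0 (lpi u)) lpi_eq subr0.
  by apply/spanP; exists (r 0).
have gu j : g (u j) = 0.
  rewrite -(gi (delta_mx 0 j)) /= /free_fun (bigD1 j) //= mxE !eqxx scale1r.
  rewrite big1 ?addr0 // => l lj.
  by rewrite mxE eqxx /= (negPf lj) scale0r.
have hd l (v : quotm gA ud) : gm_deg l v -> gm_deg l (lfactor_hom gu v).
  by move=> [m ml ->]; rewrite /= (lfactorE gu); apply: gh_deg.
exists (@GrHom _ _ (quotm gA ud) N (lfactor_hom gu) hd).
split=> [m|h hE v] /=; first exact: (lfactorE gu).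
by have [m ->] := lpiP v; rewrite (lfactorE gu) -(hE m).
Qed.

(** The kernel of an injection is the zero module and its cokernel is the
quotient module, so only the dimension of the latter matters. *)
Lemma free_hom_serre_iso : (forall r, i r = 0 -> r = 0) ->
  (exists t (y : 'I_t -> M), forall m, exists c : 'I_t -> k,
      m - \sum_l sc (c l) *: y l \in span_pred u) ->
  serre_iso (fdim sc (A_ := A_)) (i : Defs.hom (free_grmod gA d : C) M).
Proof.
move=> i0 [t [y yE]]; split.
  exists zero_mod, (zero_hom zero_mod (free_grmod gA d)).
  split; first exact: free_hom_kernel.
  exists 0%N, (fun=> 0) => m; exists (fun=> 0); rewrite big_ord0.
  by have /zero_objE := zero_mod0; apply.
exists (quotm gA ud), (quotm_pi gA ud); split; first exact: free_hom_cokernel.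
exists t, (fun l => lpi u (y l)) => v; have [m ->] := lpiP v.
have [c mE] := yE m; exists c; move/lpi_eq: mE => ->.
by rewrite linear_sum; apply: eq_bigr => l _; rewrite linearZ.
Qed.

End Quotient.

End SerreIso.
(** * Linear spans and bases over the ground field *)

Section Span.
Variables (k : fieldType) (A : pzRingType) (sc : k -> A).
Hypotheses (sc1 : sc 1 = 1) (scD : forall c d, sc (c + d) = sc c + sc d).
Hypothesis (scM : forall c d, sc (c * d) = sc c * sc d).
Variable M : lmodType A.
Implicit Types (s : seq M) (m b : M) (c d : k).

Let sc0 : sc 0 = 0. Proof. exact: morph_add0 scD. Qed.
Let scN c : sc (- c) = - sc c. Proof. exact: morph_addN scD c. Qed.

(** The structure of k-space on an A-module stays implicit in the action of the
scalars [sc c]; the recursion suits inductions on a spanning list. *)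
Fixpoint inspan s m : Prop :=
  if s is b :: s' then exists c m', inspan s' m' /\ m = sc c *: b + m' else m = 0.

Lemma inspan0 s : inspan s 0.
Proof.
elim: s => // b s IH; exists 0, 0; split=> //.
by rewrite sc0 scale0r addr0.
Qed.

Lemma inspanD s m m' : inspan s m -> inspan s m' -> inspan s (m + m').
Proof.
elim: s m m' => [|b s IH] m m' /=; first by move=> -> ->; rewrite addr0.
move=> [c [n [sn ->]]] [c' [n' [sn' ->]]]; exists (c + c'), (n + n').
by split; [apply: IH | rewrite scD scalerDl addrACA].
Qed.

Lemma inspanZ s c m : inspan s m -> inspan s (sc c *: m).
Proof.
elim: s m => [|b s IH] m /=; first by move=> ->; rewrite scaler0.
move=> [d [n [sn ->]]]; exists (c * d), (sc c *: n).
by split; [apply: IH | rewrite scalerDr scalerA scM].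
Qed.

Lemma inspanB s m m' : inspan s m -> inspan s m' -> inspan s (m - m').
Proof.
move=> sm sm'; apply: inspanD => //.
by rewrite -scaleN1r -sc1 -scN; apply: inspanZ.
Qed.

Lemma inspan_mem s b : b \in s -> inspan s b.
Proof.
elim: s => //= a s IH; rewrite inE => /orP[/eqP ->|/IH sb].
  by exists 1, 0; split; [apply: inspan0 | rewrite sc1 scale1r addr0].
by exists 0, b; split=> //; rewrite sc0 scale0r add0r.
Qed.

Lemma inspan_trans s t m : (forall b, b \in s -> inspan t b) ->
  inspan s m -> inspan t m.
Proof.
elim: s m => [|b s IH] m st /=; first by move=> ->; apply: inspan0.
move=> [c [n [sn ->]]]; apply: inspanD.
  by apply/inspanZ/st; rewrite mem_head.
by apply: IH sn => b' b's; apply: st; rewrite inE b's orbT.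
Qed.

Lemma inspan_sub s t m : {subset s <= t} -> inspan s m -> inspan t m.
Proof. by move=> st; apply: inspan_trans => b /st; apply: inspan_mem. Qed.

Lemma inspan_map (f : M -> M) s m : {morph f : u v / u + v} ->
  (forall c u, f (sc c *: u) = sc c *: f u) ->
  inspan s m -> inspan [seq f b | b <- s] (f m).
Proof.
move=> fD fZ; elim: s m => [|b s IH] m /=; first by move=> ->; apply: morph_add0.
move=> [c [n [sn ->]]]; exists c, (f n).
by split; [apply: IH | rewrite fD fZ].
Qed.

Lemma inspan_sum s (T : Type) (r : seq T) (f : T -> M) :
  (forall t, inspan s (f t)) -> inspan s (\sum_(t <- r) f t).
Proof.
by move=> sf; apply: big_ind => //; [apply: inspan0 | apply: inspanD].
Qed.

Lemma inspan_coef s m : inspan s m ->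
  exists c : 'I_(size s) -> k, m = \sum_i sc (c i) *: s`_i.
Proof.
elim: s m => [|b s IH] m /=; first by move=> ->; exists (fun=> 0); rewrite big_ord0.
move=> [c [n [/IH[d ->] ->]]].
exists (fun i => oapp d c (unlift ord0 i)).
rewrite big_ord_recl unlift_none; congr (_ + _).
by apply: eq_bigr => i _; rewrite liftK.
Qed.

Definition kbasis (S : M -> Prop) n (u : 'I_n -> M) : Prop :=
  [/\ forall i, S (u i),
      forall m, S m -> exists c : 'I_n -> k, m = \sum_i sc (c i) *: u i
    & forall c : 'I_n -> k, \sum_i sc (c i) *: u i = 0 -> forall i, c i = 0].

(** Subspaces of finitely generated spaces have finite bases. The induction on
the list s = b :: s' adds to a basis of the intersection of S with the span of
s' one element of S that is not in this span, if there is one. *)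
Lemma kbasis_exists (S : M -> Prop) s : S 0 ->
  (forall m m', S m -> S m' -> S (m + m')) ->
  (forall c m, S m -> S (sc c *: m)) ->
  (forall m, S m -> inspan s m) -> exists n (u : 'I_n -> M), kbasis S u.
Proof.
elim: s S => [|b s IH] S S0 SD SZ Ss.
  exists 0%N, (fun=> 0); split=> [[]//|m Sm|c _ []//].
  by exists (fun=> 0); rewrite big_ord0; apply: Ss.
have [Ssub|] := pselect (forall m, S m -> inspan s m); first exact: IH Ssub.
move=> /existsNP[m0 /not_implyP[Sm0 m0s]].
have [n [u [uS uspan uind]]] : exists n (u : 'I_n -> M),
    kbasis (fun m => S m /\ inspan s m) u.
  apply: IH => [|m m' [Sm sm] [Sm' sm']|c m [Sm sm]|m []//].
  - by split=> //; apply: inspan0.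
  - by split; [apply: SD | apply: inspanD].
  by split; [apply: SZ | apply: inspanZ].
have [c [n0 [sn0 m0E]]] := Ss _ Sm0.
(* Otherwise m0 would be in the span of s. *)
have c0 : c != 0.
  by apply/eqP => c0; apply: m0s; rewrite m0E c0 sc0 scale0r add0r.
exists n.+1, (fun i => oapp u m0 (unlift ord0 i)).
have sumE (d : 'I_n.+1 -> k) :
    \sum_i sc (d i) *: oapp u m0 (unlift ord0 i) =
    sc (d ord0) *: m0 + \sum_i sc (d (lift ord0 i)) *: u i.
  rewrite big_ord_recl unlift_none; congr (_ + _).
  by apply: eq_bigr => i _; rewrite liftK.
split=> [i|m Sm|d].
- by case: unliftP => [j _|_] /=; [have [] := uS j | ].
- have [d [n1 [sn1 mE]]] := Ss _ Sm.
  have [|f fE] := uspan (m - sc (d / c) *: m0).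
    split.
      by apply: SD => //; rewrite -scaleNr -scN; apply: SZ.
    rewrite m0E scalerDr scalerA -scM divfK // mE opprD addrACA subrr add0r.
    by apply: inspanB => //; apply: inspanZ.
  exists (fun i => oapp f (d / c) (unlift ord0 i)).
  rewrite sumE unlift_none /=; under eq_bigr do rewrite liftK /=.
  by rewrite -fE addrC subrK.
rewrite sumE => d0.
have us : inspan s (\sum_i sc (d (lift ord0 i)) *: u i).
  by apply: inspan_sum => i; apply: inspanZ; have [] := uS i.
have dd0 : d ord0 = 0.
  apply/eqP; apply: contraT => dn0; case: m0s.
  have -> : m0 = sc (- (d ord0)^-1) *: \sum_i sc (d (lift ord0 i)) *: u i.
    have /eqP := d0; rewrite addrC addr_eq0 => /eqP ->.
    by rewrite scN scaleNr scalerN opprK scalerA -scM mulVf // sc1 scale1r.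
  exact: inspanZ.
rewrite dd0 sc0 scale0r add0r in d0 * => i.
by case: (unliftP ord0 i) => [j ->|-> //]; apply: uind d0 j.
Qed.

End Span.
(** * Finitely presented modules in large degrees *)
Section Regular.
Variables (k : fieldType) (A : pzRingType) (sc : k -> A).
Variables (A_ : int -> A -> Prop) (x y : A).
Hypothesis P : penrose_algebra sc A_ x y.

Lemma penrose_graded : graded_ring A_.
Proof.
split; [exact: A_grading P | exact: A_mul P |].
by apply/(A_0 P); exists 1; rewrite (sc_one P).
Qed.
Local Notation gA := penrose_graded.

Let sc1 := sc_one P.
Let scD := sc_add P.
Let scM := sc_mul P.
Let aP := acompP gA.

Lemma sc0 : sc 0 = 0. Proof. exact: morph_add0 scD. Qed.

Lemma sc_deg c : A_ 0 (sc c).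
Proof. by apply/(A_0 P); exists c. Qed.

Lemma A_neg0 i a : (i < 0)%R -> A_ i a -> a = 0.
Proof. by case: i => // n _; apply: A_neg P n a. Qed.

Lemma A_splitz i a : (0 <= i)%R -> A_ (i + 1) a ->
  exists b c, [/\ A_ i b, A_ i c & a = x * b + y * c].
Proof.
case: i => // n _; have -> : n%:Z + 1 = n.+1 by lia.
exact: A_split P n a.
Qed.

Lemma A_xy i a b : A_ i a -> A_ i b -> A_ (i + 1) (x * a + y * b).
Proof.
move=> ai bi; rewrite addrC; apply: (degD aP); apply: (A_mul P) => //.
  exact: A_x P.
exact: A_y P.
Qed.

(** The generators u i below sit in degree n, and the x v j in degree n + 1. *)
Definition nb_degs (n : int) a b (l : 'I_(a + b)) : int :=
  match split l with inl _ => n | inr _ => n + 1 end.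

Definition nb_free n a b : grmod A_ := free_grmod gA (@nb_degs n a b).

Lemma int_bound n (d : 'I_n -> int) : exists D : nat, forall j, (`|d j| <= D)%N.
Proof.
exists (\max_j `|d j|%N) => j.
exact: (@leq_bigmax _ (fun j => `|d j|%N) j).
Qed.

Section Module.
Variable M : grmod A_.
Let mP := gcompP M.

(** From degree [n0] on, M behaves like a free module: the three conditions are
the exactness of M_(m-1) -> M_m + M_m -> M_(m+1) -> 0, with maps
c |-> (0, y c) and (a, b) |-> x a + y b, which comes from the minimal resolution
of the trivial module k. *)
Record regular (n0 : int) : Prop := Regular {
  reg_split : forall (m : int) z, (n0 <= m)%R -> gm_deg (m + 1) z ->
    exists a b : M, [/\ gm_deg m a, gm_deg m b & z = x *: a + y *: b];
  reg_indep : forall (m : int) (a b : M), (n0 <= m)%R -> gm_deg m a -> gm_deg m b ->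
    x *: a + y *: b = 0 -> a = 0 /\ y *: b = 0;
  reg_kery : forall (m : int) (b : M), (n0 <= m)%R -> gm_deg m b -> y *: b = 0 ->
    exists2 c : M, gm_deg (m - 1) c & b = y *: c
}.

Lemma regularW (n0 n1 : int) : (n0 <= n1)%R -> regular n0 -> regular n1.
Proof.
move=> n01 [r1 r2 r3]; split.
- by move=> m z nm; apply: r1 (le_trans n01 nm).
- by move=> m a b nm; apply: r2 (le_trans n01 nm).
by move=> m b nm; apply: r3 (le_trans n01 nm).
Qed.

(** Write M as the quotient of a free module by a finitely generated submodule
R. In degrees above those of the generators of R, an element of R is x r1 + y r2
with r1 and r2 in R, since the coefficients of the generators have positive
degree ([rel_split] in the proof). Comparing with the decomposition in the free
module, which is unique, carries the properties of B over to M. *)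
Lemma regular_exists : exists n0, regular n0.
Proof.
have [q [d [g [p [e [r [gd rd gen rel]]]]]]] := gm_fin_pres M.
have [D dD] := int_bound d; have [E eE] := int_bound e.
pose n0 : int := (D + E)%N.
have dn j (m : int) : (n0 <= m)%R -> (0 <= m - d j)%R by move: (dD j); lia.
have en l (m : int) : (n0 <= m)%R -> (0 <= m - e l)%R by move: (eE l); lia.
pose comb (c : 'I_q -> A) : M := \sum_j c j *: g j.
have combD c c' : comb (fun j => c j + c' j) = comb c + comb c'.
  by rewrite /comb -big_split; apply: eq_bigr => j _; rewrite scalerDl.
have combZ a c : comb (fun j => a * c j) = a *: comb c.
  by rewrite /comb scaler_sumr; apply: eq_bigr => j _; rewrite scalerA.
have comb_deg i c : (forall j, A_ (i - d j) (c j)) -> gm_deg i (comb c).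
  move=> ci; apply: (deg_sum mP) => j _.
  by rewrite -(subrK (d j) i); apply: gm_scale (ci j) (gd j).
have coord i z : gm_deg i z ->
    exists c, (forall j, A_ (i - d j) (c j)) /\ z = comb c.
  move=> zi; have [c cE] := gen z.
  exists (fun j => acomp gA (i - d j) (c j)); split.
    by move=> j; apply: comp_deg aP _ _.
  exact: hom_coord gd zi cE.
have split_row (i : int) c : (n0 <= i)%R -> (forall j, A_ (i + 1 - d j) (c j)) ->
    exists c1 c2, [/\ forall j, A_ (i - d j) (c1 j), forall j, A_ (i - d j) (c2 j)
                    & forall j, c j = x * c1 j + y * c2 j].
  move=> ni ci.
  have /choice[f fP] : forall j, exists f : A * A, [/\ A_ (i - d j) f.1,
      A_ (i - d j) f.2 & c j = x * f.1 + y * f.2].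
    move=> j; have [||b1 [b2 bP]] := @A_splitz (i - d j) (c j).
    - exact: dn.
    - by rewrite addrAC; apply: ci.
    by exists (b1, b2).
  by exists (fun j => (f j).1), (fun j => (f j).2); split=> j; have [] := fP j.
have rel_split (i : int) c : (n0 <= i)%R -> (forall j, A_ (i + 1 - d j) (c j)) ->
    comb c = 0 -> exists c1 c2, [/\ comb c1 = 0, comb c2 = 0
                                 & forall j, c j = x * c1 j + y * c2 j].
  move=> ni ci /rel[a aE].
  have /choice[f fP] : forall l, exists f : A * A,
      acomp gA (i + 1 - e l) (a l) = x * f.1 + y * f.2.
    move=> l; have [||b1 [b2 [_ _ bE]]] :=
      @A_splitz (i - e l) (acomp gA (i + 1 - e l) (a l)).
    - exact: en.
    - by rewrite addrAC; apply: comp_deg aP _ _.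
    by exists (b1, b2).
  exists (fun j => \sum_l (f l).1 * r l j), (fun j => \sum_l (f l).2 * r l j).
  split=> [||j].
  - by apply/rel; exists (fun l => (f l).1).
  - by apply/rel; exists (fun l => (f l).2).
  rewrite -(comp_id aP (ci j)) aE (comp_sum aP) !mulr_sumr -big_split.
  apply: eq_bigr => l _; rewrite (acompM _ _ _ (rd l j)).
  rewrite (_ : i + 1 - d j - (e l - d j) = i + 1 - e l); last by lia.
  by rewrite fP mulrDl !mulrA.
exists n0; split=> [m z nm zm|m a b nm am bm ab0|m b nm bm yb0].
- have [c [cd ->]] := coord _ _ zm.
  have [c1 [c2 [c1d c2d cE]]] := split_row _ _ nm cd.
  exists (comb c1), (comb c2); split; try exact: comb_deg.
  rewrite -!combZ -combD; apply: eq_bigr => j _; by rewrite cE.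
- have [f [fd aE]] := coord _ _ am; have [h [hd bE]] := coord _ _ bm.
  have [||f1 [h1 [f10 h10 E1]]] :=
    @rel_split m (fun j => x * f j + y * h j) nm.
  + by move=> j; rewrite addrAC; apply: A_xy.
  + by rewrite combD !combZ -aE -bE.
  have E2 j : f j = f1 j /\ y * h j = y * h1 j.
    have /(A_indep P)[e1 e2] : x * (f j - f1 j) + y * (h j - h1 j) = 0.
      by rewrite !mulrBr addrACA -opprD -E1 subrr.
    by split; apply/eqP; rewrite -subr_eq0 ?e1 // -mulrBr e2.
  split; first by rewrite aE -f10; apply: eq_bigr => j _; have [-> _] := E2 j.
  rewrite bE -combZ -[RHS](scaler0 _ y) -h10 -combZ.
  by apply: eq_bigr => j _; have [_ ->] := E2 j.
have [h [hd bE]] := coord _ _ bm.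
have [||f1 [h1 [f10 h10 E1]]] := @rel_split m (fun j => x * 0 + y * h j) nm.
- by move=> j; rewrite addrAC; apply: A_xy => //; apply: deg0 aP _.
- by rewrite -yb0 bE -combZ; apply: eq_bigr => j _; rewrite mulr0 add0r.
have /choice[c cE] : forall j, exists c, h j - h1 j = y * c.
  move=> j; apply: (A_kery P).
  have /(A_indep P)[] : x * (- f1 j) + y * (h j - h1 j) = 0; last by [].
  rewrite mulrBr mulrN addrCA -opprD -E1 mulr0 add0r.
  by rewrite subrr.
exists (gcomp (m - 1) (comb c)); first exact: comp_deg mP _ _.
rewrite -(gcompZl _ _ (A_y P)) -combZ -{1}(comp_id mP bm) bE; congr gcomp.
rewrite -[LHS]subr0 -h10 -sumrB.
by apply: eq_bigr => j _; rewrite -scalerBl cE.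
Qed.

(** The starting degree is [n - 1], so that elements of degree [n] already split
as a sum of an element of x M_(n-1) and an element of y M_(n-1). *)
Record normal_basis (n : int) a b (u : 'I_a -> M) (v : 'I_b -> M) : Prop :=
  NormalBasis {
    nb_regular : regular (n - 1);
    nb_x : kbasis sc (fun m => exists2 w, gm_deg (n - 1) w & m = x *: w) u;
    nb_y : kbasis sc (fun m => exists2 w, gm_deg (n - 1) w & m = y *: w) v
}.

Let scZ c (a : A) (m : M) : a *: (sc c *: m) = sc c *: (a *: m).
Proof. by rewrite !scalerA (sc_central P). Qed.

(** The list consists of the words of length t, whatever z is. *)
Lemma A_span (t : nat) : exists s : seq A, forall a, A_ t a ->
  forall z : M, inspan sc [seq b *: z | b <- s] (a *: z).
Proof.
elim: t => [|t [s sP]].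
  exists [:: 1] => _ /(A_0 P)[c ->] z /=.
  by exists c, 0; rewrite scale1r addr0.
exists ([seq x * b | b <- s] ++ [seq y * b | b <- s]) => a.
move=> /(A_split P)[b [c [bt ct ->]]] z.
have sub e : [seq b *: z | b <- [seq e * b | b <- s]] =
             [seq e *: m | m <- [seq b *: z | b <- s]].
  by rewrite -!map_comp; apply: eq_map => l /=; rewrite scalerA.
have lin e l : A_ t l -> inspan sc [seq b *: z | b <- [seq e * b | b <- s]]
                                   ((e * l) *: z).
  move=> lt; rewrite sub -scalerA; apply: inspan_map => [u v|f u|].
  - exact: scalerDr.
  - exact: scZ.
  exact: sP.
rewrite scalerDl map_cat; apply: (inspanD scD).
  apply: (inspan_sub sc1 scD scM) (lin x b bt) => m.
  by rewrite mem_cat => ->.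
apply: (inspan_sub sc1 scD scM) (lin y c ct) => m.
by rewrite mem_cat orbC => ->.
Qed.

Lemma deg_span (i : int) : exists s, forall m : M, gm_deg i m -> inspan sc s m.
Proof.
have [q [d [g [_ [_ [_ [gd _ gen _]]]]]]] := gm_fin_pres M.
have /choice[s sP] : forall j, exists s : seq A, forall a, A_ (i - d j) a ->
    forall z : M, inspan sc [seq b *: z | b <- s] (a *: z).
  move=> j; case: (i - d j) => [t|t]; first exact: A_span.
  by exists [::] => a /(A_neg P) -> z /=; rewrite scale0r.
exists (flatten [seq [seq b *: g j | b <- s j] | j <- enum 'I_q]) => m mi.
have [c mE] := gen m; rewrite (hom_coord gA gd mi mE).
apply: (inspan_sum scD) => j.
apply: (inspan_sub sc1 scD scM); last exact: sP (comp_deg aP _ _) _.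
move=> z zs; apply/flattenP; exists [seq b *: g j | b <- s j] => //.
by apply/mapP; exists j; rewrite ?mem_enum.
Qed.

Lemma deg_bounded : exists D : int, forall i m, (i < D)%R -> gm_deg i m -> m = 0 :> M.
Proof.
have [q [d [g [_ [_ [_ [gd _ gen _]]]]]]] := gm_fin_pres M.
have [D dD] := int_bound d; exists (- D%:Z) => i m iD mi.
have [c mE] := gen m; rewrite (hom_coord gA gd mi mE) big1 // => j _.
rewrite (@A_neg0 _ _ _ (comp_deg aP (i - d j) _)) ?scale0r //.
by move: (dD j); lia.
Qed.

Lemma deg_step e n (w : M) : A_ 1 e -> gm_deg (n - 1) w -> gm_deg n (e *: w).
Proof.
by move=> e1 wn; rewrite (_ : n = 1 + (n - 1)); [apply: gm_scale | lia].
Qed.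

Lemma mul_kbasis_exists e n : A_ 1 e -> exists a (u : 'I_a -> M),
  kbasis sc (fun m => exists2 w, gm_deg (n - 1) w & m = e *: w) u.
Proof.
move=> e1; have [s sP] := deg_span n.
apply: (kbasis_exists sc1 scD scM (s := s)).
- by exists 0; rewrite ?scaler0 //; apply: deg0 mP _.
- move=> _ _ [w wn ->] [w' w'n ->]; exists (w + w'); rewrite ?scalerDr //.
  exact: (degD mP).
- move=> c _ [w wn ->]; exists (sc c *: w); last by rewrite scZ.
  by rewrite -[n - 1]add0r; apply: gm_scale (sc_deg c) wn.
by move=> _ [w wn ->]; apply/sP/deg_step.
Qed.

Lemma mul_kcomb e n a (u : 'I_a -> M) :
  (forall i, exists2 w, gm_deg (n - 1) w & u i = e *: w) ->
  forall p : 'I_a -> k,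
  exists2 w, gm_deg (n - 1) w & \sum_i sc (p i) *: u i = e *: w.
Proof.
move=> uE p.
have /choice[f fP] : forall i, exists w, gm_deg (n - 1) w /\ u i = e *: w.
  by move=> i; have [w wn ->] := uE i; exists w.
exists (\sum_i sc (p i) *: f i).
  apply: (deg_sum mP) => i _; rewrite -[n - 1]add0r.
  by apply: gm_scale (sc_deg _) _; have [] := fP i.
rewrite scaler_sumr; apply: eq_bigr => i _.
by rewrite scZ; have [_ ->] := fP i.
Qed.

Lemma normal_basis_exists : exists n0 : int, forall n, (n0 <= n)%R ->
  exists a b (u : 'I_a -> M) (v : 'I_b -> M), normal_basis n u v.
Proof.
have [n0 reg] := regular_exists; exists (n0 + 1) => n n0n.
have [a [u uP]] := mul_kbasis_exists n (A_x P).
have [b [v vP]] := mul_kbasis_exists n (A_y P).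
exists a, b, u, v; split=> //; apply: regularW reg; lia.
Qed.

Section NormalBasis.
Variables (n : int) (a b : nat) (u : 'I_a -> M) (v : 'I_b -> M).
Hypothesis nb : normal_basis n u v.

Let reg m : (n - 1 <= m)%R -> regular m.
Proof. by move=> nm; apply: regularW (nb_regular nb). Qed.

Lemma nb_xdeg i : gm_deg n (u i).
Proof.
by have [/(_ i)[w wn ->] _ _] := nb_x nb; apply: deg_step (A_x P) wn.
Qed.

Lemma nb_ydeg i : gm_deg n (v i).
Proof.
by have [/(_ i)[w wn ->] _ _] := nb_y nb; apply: deg_step (A_y P) wn.
Qed.

Lemma nb_yv i : y *: v i = 0.
Proof.
have [/(_ i)[w wn ->] _ _] := nb_y nb.
by rewrite scalerA (A_yy P) scale0r.
Qed.

Lemma nb_spanx w : gm_deg (n - 1) w -> exists p : 'I_a -> k,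
  x *: w = \sum_i sc (p i) *: u i.
Proof. by move=> wn; have [_ + _] := nb_x nb; apply; exists w. Qed.

Lemma nb_spany w : gm_deg (n - 1) w -> exists p : 'I_b -> k,
  y *: w = \sum_i sc (p i) *: v i.
Proof. by move=> wn; have [_ + _] := nb_y nb; apply; exists w. Qed.

(** The combinations of the free generators: the u i, and the x v j in place of
the v j, which are killed by y. *)
Definition nb_comb (p : 'I_a -> A) (q : 'I_b -> A) : M :=
  \sum_i p i *: u i + \sum_j q j *: (x *: v j).

Lemma nb_combD p q p' q' : nb_comb p q + nb_comb p' q' =
  nb_comb (fun i => p i + p' i) (fun j => q j + q' j).
Proof.
rewrite /nb_comb addrACA -!big_split; congr (_ + _);
  by apply: eq_bigr => i _; rewrite scalerDl.
Qed.

Lemma nb_combZ e p q :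
  e *: nb_comb p q = nb_comb (fun i => e * p i) (fun j => e * q j).
Proof.
rewrite /nb_comb scalerDr !scaler_sumr; congr (_ + _);
  by apply: eq_bigr => i _; rewrite !scalerA.
Qed.

Lemma nb_comb_deg (t : int) p q : (forall i, A_ t (p i)) ->
  (forall j, A_ (t - 1) (q j)) -> gm_deg (n + t) (nb_comb p q).
Proof.
move=> pt qt; apply: (degD mP); apply: (deg_sum mP) => i _.
  by rewrite addrC; apply: gm_scale (pt i) (nb_xdeg i).
rewrite (_ : n + t = (t - 1) + (1 + n)); last by lia.
by apply: gm_scale (qt i) (gm_scale (A_x P) (nb_ydeg i)).
Qed.

(** The v j themselves are needed only in degree n: each step up multiplies
by x, which turns them into x v j, or by y, which kills them. *)
Lemma nb_gen (t : nat) z : gm_deg (n + t%:Z) z -> exists p q s,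
  [/\ forall i, A_ t (p i), forall j, A_ (t%:Z - 1) (q j),
      z = nb_comb p q + \sum_j sc (s j) *: v j
    & (0 < t)%N -> forall j, s j = 0].
Proof.
elim: t z => [|t IH] z.
  rewrite addr0 -{1}(subrK 1 n) => /(reg_split (nb_regular nb) (lexx _)).
  move=> [w [w' [wn w'n ->]]].
  have [p ->] := nb_spanx wn; have [q ->] := nb_spany w'n.
  exists (fun i => sc (p i)), (fun=> 0), q; split=> //.
  - by move=> i; apply: sc_deg.
  - by move=> j; apply: deg0 aP _.
  by rewrite /nb_comb [X in _ + X + _]big1 ?addr0 // => j _; rewrite scale0r.
have -> : n + t.+1%:Z = n + t%:Z + 1 by lia.
have nt : (n - 1 <= n + t%:Z)%R by lia.
move=> /(reg_split (reg nt) (lexx _))[z1 [z2 [z1t z2t ->]]].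
have [p1 [q1 [s1 [p1t q1t -> s10]]]] := IH _ z1t.
have [p2 [q2 [s2 [p2t q2t -> _]]]] := IH _ z2t.
exists (fun i => x * p1 i + y * p2 i),
  (fun j => (x * q1 j + sc (s1 j)) + y * q2 j), (fun=> 0); split=> //.
- by move=> i; rewrite (_ : t.+1%:Z = t%:Z + 1); [apply: A_xy | lia].
- move=> j; rewrite (_ : _ - 1 = t%:Z); last by lia.
  rewrite addrAC; apply: (degD aP).
    by rewrite -(subrK 1 t%:Z); apply: A_xy.
  case: t {IH z1t z2t nt p1t p2t q2t q1t} s10 => [_|t ->//]; first exact: sc_deg.
  by rewrite sc0; apply: deg0 aP _.
rewrite [X in _ = _ + X]big1 ?addr0 => [|j _]; last by rewrite sc0 scale0r.
rewrite 2![_ *: (nb_comb _ _ + _)]scalerDr [X in _ + (_ + X)](_ : _ = 0) ?addr0; last first.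
  by rewrite scaler_sumr big1 // => j _; rewrite scZ nb_yv scaler0.
have -> : x *: (\sum_j sc (s1 j) *: v j) = nb_comb (fun=> 0) (fun j => sc (s1 j)).
  rewrite /nb_comb [X in X + _]big1 ?add0r => [|i _]; last by rewrite scale0r.
  by rewrite scaler_sumr; apply: eq_bigr => j _; rewrite scZ.
rewrite !nb_combZ !nb_combD; congr nb_comb.
by apply/funext => i; rewrite addr0.
Qed.

Lemma nb_indep0 w w' (p : 'I_a -> k) (q : 'I_b -> k) :
  \sum_i sc (p i) *: u i = x *: w -> gm_deg (n - 1) w ->
  \sum_j sc (q j) *: v j = y *: w' -> gm_deg (n - 1) w' ->
  x *: w + y *: w' = 0 -> (forall i, p i = 0) /\ (forall j, q j = 0).
Proof.
move=> pE wn qE w'n /(reg_indep (nb_regular nb) (lexx _) wn w'n)[w0 w'0].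
split.
  by have [_ _] := nb_x nb; apply; rewrite pE w0 scaler0.
by have [_ _] := nb_y nb; apply; rewrite qE w'0.
Qed.

(** Induction on the degree of the coefficients. Splitting them by first letters,
a relation becomes x S + y T = 0, so S = 0 and y T = 0. The induction hypothesis
applies to S. As y T = 0, T is y z for some z; by [nb_gen] y z is y times a
combination, so the induction hypothesis applied to T - y z shows that
the coefficients of T are multiples of y, and y kills them. In the first step the
coefficients are scalars, and the independence of u and v replaces the
induction hypothesis. *)
Lemma nb_indep (t : nat) p q : (forall i, A_ t (p i)) ->
  (forall j, A_ (t%:Z - 1) (q j)) -> nb_comb p q = 0 ->
  (forall i, p i = 0) /\ (forall j, q j = 0).
Proof.
elim: t p q => [|t IH] p q pt qt pq0.
  have q0 j : q j = 0 by apply: A_neg0 (qt j); lia.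
  split=> // i.
  have /choice[c cE] : forall i, exists c, p i = sc c by move=> l; apply/(A_0 P).
  rewrite cE; suff -> : c i = 0 by exact: sc0.
  have [_ _] := nb_x nb; apply; rewrite -[RHS]pq0 /nb_comb [X in _ = _ + X]big1 ?addr0.
        by apply: eq_bigr => l _; rewrite cE.
  by move=> j _; rewrite q0 scale0r.
have /choice[f fP] : forall i, exists f : A * A,
    [/\ A_ t f.1, A_ t f.2 & p i = x * f.1 + y * f.2].
  by move=> i; have [b1 [b2 bP]] := A_split P (pt i); exists (b1, b2).
have nt : (n - 1 <= n + t%:Z)%R by lia.
have {}qt j : A_ t (q j).
  by have := qt j; rewrite (_ : _ - 1 = t%:Z) //; lia.
suff [qE pE] : (forall j, q j = 0) /\ (forall i, (f i).1 = 0 /\ y * (f i).2 = 0).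
  split=> // i; have [_ _ ->] := fP i; have [-> ->] := pE i.
  by rewrite mulr0 addr0.
case: t IH pt fP nt qt => [|t] IH pt fP nt qt.
  have /choice[c1 c1E] : forall i, exists c, (f i).1 = sc c.
    by move=> i; apply/(A_0 P); have [] := fP i.
  have /choice[c2 c2E] : forall i, exists c, (f i).2 = sc c.
    by move=> i; apply/(A_0 P); have [] := fP i.
  have /choice[c3 c3E] : forall j, exists c, q j = sc c.
    by move=> j; apply/(A_0 P); apply: qt.
  have [ux _ _] := nb_x nb; have [vy _ _] := nb_y nb.
  have [w1 w1n w1E] := mul_kcomb ux c1; have [w2 w2n w2E] := mul_kcomb ux c2.
  have [w3 w3n w3E] := mul_kcomb vy c3.
  have nn : (n - 1 <= n)%R by lia.
  have [|||w13 w20] := reg_indep (reg nn) (lexx n)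
      (a := x *: w1 + y *: w3) (b := x *: w2).
  - by apply: (degD mP); [apply: deg_step (A_x P) w1n | apply: deg_step (A_y P) w3n].
  - exact: deg_step (A_x P) w2n.
  - rewrite -w1E -w2E -w3E -[RHS]pq0 /nb_comb scalerDr !scaler_sumr addrAC.
    rewrite -big_split; congr (_ + _); apply: eq_bigr => i _ /=.
      by have [_ _ ->] := fP i; rewrite c1E c2E scalerDl !scalerA.
    by rewrite c3E scZ.
  have [c10 c30] := nb_indep0 w1E w1n w3E w3n w13.
  have [w4 w4n w2y] := reg_kery (reg nn) (lexx n) (deg_step (A_x P) w2n) w20.
  have w24 : x *: w2 + y *: (- w4) = 0 by rewrite scalerN w2y subrr.
  have q0 : \sum_j sc ((fun=> 0) j) *: v j = y *: (- w4).
    rewrite big1 => [|j _]; last by rewrite sc0 scale0r.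
    have nn1 : (n - 1 <= n - 1)%R by [].
    have [_ ->] := reg_indep (reg nn1) nn1 w2n (degN mP w4n) w24.
    by [].
  have [c20 _] := nb_indep0 w2E w2n q0 (degN mP w4n) w24.
  split=> [j|i]; first by rewrite c3E c30 sc0.
  by rewrite c1E c2E c10 c20 sc0 mulr0.
have /choice[h hP] : forall j, exists h : A * A,
    [/\ A_ t h.1, A_ t h.2 & q j = x * h.1 + y * h.2].
  by move=> j; have [b1 [b2 bP]] := A_split P (qt j); exists (b1, b2).
pose p1 i := (f i).1; pose p2 i := (f i).2; pose q1 j := (h j).1; pose q2 j := (h j).2.
have p1t i : A_ t.+1 (p1 i) by have [] := fP i.
have p2t i : A_ t.+1 (p2 i) by have [] := fP i.
have tE : t.+1%:Z - 1 = t%:Z by lia.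
have q1t j : A_ (t.+1%:Z - 1) (q1 j) by rewrite tE; have [] := hP j.
have q2t j : A_ (t.+1%:Z - 1) (q2 j) by rewrite tE; have [] := hP j.
have [|||e1 e2] := reg_indep (reg nt) (lexx _)
    (a := nb_comb p1 q1) (b := nb_comb p2 q2).
- exact: nb_comb_deg.
- exact: nb_comb_deg.
- rewrite !nb_combZ nb_combD -[RHS]pq0; congr nb_comb; apply/funext => i.
    by have [_ _ ->] := fP i.
  by have [_ _ ->] := hP i.
have [p10 q10] := IH _ _ p1t q1t e1.
have [z] := reg_kery (reg nt) (lexx _) (nb_comb_deg p2t q2t) e2.
rewrite (_ : n + t.+1%:Z - 1 = n + t%:Z); last by lia.
move=> /nb_gen[r [s [c [rt st -> _]]]].
rewrite scalerDr nb_combZ scaler_sumr [X in _ + X]big1 ?addr0; last first.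
  by move=> j _; rewrite scZ nb_yv scaler0.
move=> e3.
have [|||p2r q2s] := IH (fun i => p2 i - y * r i) (fun j => q2 j - y * s j).
- move=> i; apply: (degB aP) => //.
  by rewrite (_ : t.+1%:Z = 1 + t%:Z); [apply: A_mul P _ _ _ _ (A_y P) _ | lia].
- move=> j; apply: (degB aP) => //.
  by rewrite (_ : t.+1%:Z - 1 = 1 + (t%:Z - 1)); [apply: A_mul P _ _ _ _ (A_y P) _ | lia].
- transitivity (nb_comb p2 q2 + (-1) *: nb_comb p2 q2); last first.
    by rewrite scaleN1r subrr.
  rewrite {2}e3 nb_combZ nb_combD; congr nb_comb; apply/funext => i;
  by rewrite mulN1r.
split=> [j|i].
  have [_ _ ->] := hP j; rewrite -/(q1 j) -/(q2 j) q10 mulr0 add0r.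
  by rewrite -[q2 j](subrK (y * s j)) q2s add0r mulrA (A_yy P) mul0r.
split; first exact: p10.
rewrite -/(p2 i) -[p2 i](subrK (y * r i)) p2r add0r mulrA (A_yy P) mul0r.
by [].
Qed.

Definition nb_gens (l : 'I_(a + b)) : M :=
  match split l with inl i => u i | inr j => x *: v j end.

Lemma nb_gens_deg l : gm_deg (nb_degs n l) (nb_gens l).
Proof.
rewrite /nb_degs /nb_gens; case: split => i; first exact: nb_xdeg.
by rewrite addrC; apply: gm_scale (A_x P) (nb_ydeg i).
Qed.

Lemma nb_gensE (r : 'rV[A]_(a + b)) : free_fun nb_gens r =
  nb_comb (fun i => r 0 (lshift b i)) (fun j => r 0 (rshift a j)).
Proof.
rewrite /free_fun big_split_ord; congr (_ + _); apply: eq_bigr => i _.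
  by rewrite /nb_gens (unsplitK (inl i)).
by rewrite /nb_gens (unsplitK (inr i)).
Qed.

Definition nb_hom : grhom (nb_free n a b) M := free_hom gA nb_gens_deg.

(** Independence in each degree gives injectivity, since the map is graded. *)
Lemma nb_hom_inj r : nb_hom r = 0 -> r = 0.
Proof.
move=> r0; suff H l i : acomp gA i (r 0 l) = 0.
  by apply/rowP => l; rewrite mxE; apply: (comp_eq0 aP).
pose p (m : int) i := acomp gA (m - n) (r 0 (lshift b i)).
pose q (m : int) j := acomp gA (m - (n + 1)) (r 0 (rshift a j)).
have pq0 m : nb_comb (p m) (q m) = 0.
  have := congr1 (gcomp m) r0; rewrite (comp0 mP) => <-.
  rewrite /= nb_gensE /nb_comb (compD mP) !(comp_sum mP); congr (_ + _).
    by apply: eq_bigr => l' _; rewrite (gcompZr gA _ _ (nb_xdeg l')).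
  apply: eq_bigr => l' _; rewrite (gcompZr gA _ _ (gm_scale (A_x P) (nb_ydeg l'))).
  by rewrite [1 + n]addrC.
have pq m : (forall i, p m i = 0) /\ (forall j, q m j = 0).
  have [mn|nm] := ltP m n.
    by split=> l'; [apply: A_neg0 (comp_deg aP _ _) | apply: A_neg0 (comp_deg aP _ _)]; lia.
  have mE : m - n = `|m - n|%N by lia.
  apply: (@nb_indep `|m - n|%N) => // l'; rewrite -?mE; first exact: comp_deg.
  by rewrite -addrA -opprD; apply: comp_deg.
case: (split_ordP l) => l' ->.
  have [/(_ l') + _] := pq (i + n); rewrite /p addrK.
  by [].
by have [_ /(_ l')] := pq (i + (n + 1)); rewrite /q addrK.
Qed.

(** Above degree n, the generators u i and x v j suffice; so the cokernel
is concentrated in the finitely many degrees from the lowest one to n. *)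
Lemma nb_gens_high i z : (n < i)%R -> gm_deg i z -> z \in span_pred nb_gens.
Proof.
move=> ni zi; have iE : i = n + `|i - n|%N%:Z by lia.
rewrite iE in zi; have [p [q [s [_ _ -> s0]]]] := nb_gen zi.
rewrite [X in _ + X]big1 ?addr0 => [|j _]; last by rewrite s0 ?sc0 ?scale0r //; lia.
apply/spanP.
exists (fun l => match split l with inl i => p i | inr j => q j end).
rewrite big_split_ord; congr (_ + _); apply: eq_bigr => l _.
  by rewrite /nb_gens (unsplitK (inl l)).
by rewrite /nb_gens (unsplitK (inr l)).
Qed.

Lemma nb_hom_serre_iso :
  serre_iso (fdim sc (A_ := A_)) (nb_hom : Defs.hom (nb_free n a b : gr A_) M).
Proof.
apply: free_hom_serre_iso; first exact: nb_hom_inj.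
have [D M0] := deg_bounded.
have /choice[s sP] : forall j : nat, exists s, forall m : M,
  gm_deg (n - j%:Z) m -> inspan sc s m by move=> j; apply: deg_span.
(* The degrees n, n - 1, ..., D, below which M vanishes, span the cokernel. *)
pose L := flatten [seq s j | j <- iota 0 `|n - D|.+1].
suff LP : forall m, exists2 m', inspan sc L m' & m - m' \in span_pred nb_gens.
  exists (size L), (fun l => L`_l) => m; have [m' /inspan_coef[c ->] mm'] := LP m.
  by exists c.
apply: (comp_ind mP).
- by exists 0; [apply: (inspan0 scD) | rewrite subrr; apply: rpred0].
- move=> m1 m2 [m1' L1 S1] [m2' L2 S2]; exists (m1' + m2').
    exact: (inspanD scD).
  by rewrite opprD addrACA; apply: rpredD.
move=> i m mi; have [ni|i_n] := ltP n i.
  exists 0; first exact: (inspan0 scD).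
  by rewrite subr0; apply: nb_gens_high mi.
have [iD|Di] := ltP i D.
  exists 0; first exact: (inspan0 scD).
  by rewrite (M0 _ _ iD mi) subr0; apply: rpred0.
exists m; last by rewrite subrr; apply: rpred0.
have iE : i = n - `|n - i|%N%:Z by lia.
rewrite iE in mi; have := sP _ _ mi.
apply: (inspan_sub sc1 scD scM) => z zs; apply/flattenP; exists (s `|n - i|%N) => //.
by apply: map_f; rewrite mem_iota; lia.
Qed.

End NormalBasis.

End Module.

End Regular.
(** * Quasi-inverses in categories *)

Section Regularity.
Variable C : category.
Local Notation "f ~~ g" := (@heq C _ _ f g) (at level 70, no associativity).
Local Notation "g \* f" := (@Defs.comp C _ _ _ g f) (at level 40, left associativity).

#[local] Instance heq_equiv X Y : Equivalence (@heq C X Y).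
Proof.
split; [exact: (@heq_refl C) | exact: (@heq_sym C) | exact: (@heq_trans C)].
Qed.

#[local] Instance comp_proper X Y Z :
  Proper (@heq C Y Z ==> @heq C X Y ==> @heq C X Z) (@Defs.comp C X Y Z).
Proof. by move=> g g' gg' f f' ff'; apply: comp_heq. Qed.

#[local] Hint Resolve heq_refl : core.

Definition quasi_inverse (X Y : C) (f : Defs.hom X Y) (g : Defs.hom Y X) : Prop :=
  f \* g \* f ~~ f.

Definition inverse (X Y : C) (f : Defs.hom X Y) (g : Defs.hom Y X) : Prop :=
  g \* f ~~ idm X /\ f \* g ~~ idm Y.

(** If f q f = f with f monic then q f = 1, so a map g out of the source of f
extends by g q; dually for epic f. *)
Lemma regular_inj_proj : (forall (X Y : C) (f : Defs.hom X Y),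
    exists g, quasi_inverse f g) ->
  forall M : C, injective_obj M /\ projective_obj M.
Proof.
move=> reg M; split=> X Y f fmono g; have [q qf] := reg _ _ f.
  exists (g \* q); rewrite -comp_assoc.
  have qf1 : q \* f ~~ idm X by apply: fmono; rewrite comp_assoc qf comp_idr.
  by rewrite qf1 comp_idr.
exists (q \* g); rewrite comp_assoc.
have fq1 : f \* q ~~ idm Y by apply: fmono; rewrite qf comp_idl.
by rewrite fq1 comp_idl.
Qed.

(** As f = j a i', both sides reduce to j (a b a) i'. *)
Lemma quasi_inverse_transport (X Y F G : C) (i : Defs.hom F X) i' (j : Defs.hom G Y) j'
    (a : Defs.hom F G) (b : Defs.hom G F) (f : Defs.hom X Y) :
  inverse i i' -> inverse j j' -> j \* a ~~ f \* i -> quasi_inverse a b ->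
  quasi_inverse f (i \* b \* j').
Proof.
move=> [i'i ii'] [j'j jj'] jafi aba.
have fE : f ~~ j \* a \* i' by rewrite jafi -comp_assoc ii' comp_idr.
rewrite /quasi_inverse {2}fE !comp_assoc -jafi -(comp_assoc _ j' j) j'j comp_idr.
rewrite -(comp_assoc j a b) -(comp_assoc j _ a) aba.
by rewrite -fE.
Qed.

Lemma inverse_unique (X Y : C) (f : Defs.hom X Y) g h :
  inverse f g -> quasi_inverse f h -> h ~~ g.
Proof.
move=> [gf fg] fhf.
have -> : h ~~ g \* (f \* h \* f) \* g.
  by rewrite !comp_assoc gf comp_idl -comp_assoc fg comp_idr.
by rewrite fhf gf comp_idl.
Qed.

(** When f is invertible, a quasi-inverse b of its matrix a represents the
inverse of f. *)
Lemma inverse_square (X Y F G : C) (i : Defs.hom F X) i' (j : Defs.hom G Y) j'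
    (a : Defs.hom F G) (b : Defs.hom G F) (f : Defs.hom X Y) g :
  inverse i i' -> inverse j j' -> j \* a ~~ f \* i -> quasi_inverse a b ->
  inverse f g -> i \* b ~~ g \* j.
Proof.
move=> ii' jj' jafi ab fg.
have := quasi_inverse_transport ii' jj' jafi ab.
move=> /(inverse_unique fg) <-; have [j'j _] := jj'.
by rewrite -comp_assoc j'j comp_idr.
Qed.

Lemma square_comp (X Y Z F G H : C) (i : Defs.hom F X) (j : Defs.hom G Y)
    (l : Defs.hom H Z) (a : Defs.hom F G) (b : Defs.hom G H)
    (f : Defs.hom X Y) (g : Defs.hom Y Z) :
  j \* a ~~ f \* i -> l \* b ~~ g \* j -> l \* (b \* a) ~~ (g \* f) \* i.
Proof. by move=> jafi lbgj; rewrite comp_assoc lbgj -comp_assoc jafi comp_assoc. Qed.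

End Regularity.
(** * Regularity of the quotient category *)

Section QuotientCategory.
Variables (k : fieldType) (A : pzRingType) (sc : k -> A).
Variables (A_ : int -> A -> Prop) (x y : A).
Hypothesis P : penrose_algebra sc A_ x y.
Local Notation gA := (penrose_graded P).
Local Notation F := (nb_free P).
Local Notation Q := (qgr sc A_).
Let aP := acompP gA.
Let scD := sc_add P.

Section Diagonal.
Variables (n : int) (a b a' b' : nat) (al : 'M[k]_(a, a')) (be : 'M[k]_(b, b')).

(** Block diagonal scalar matrices, acting on row vectors on the right; the
blocks respect the two degrees of the generators. *)
Definition diag_mat : 'M[A]_(a + b, a' + b') := map_mx sc (block_mx al 0 0 be).

Lemma diag_deg i (r : F n a b) :
  gm_deg i r -> gm_deg (g := F n a' b') i (mulmxr diag_mat r).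
Proof.
move=> ri l; rewrite /= !mxE; apply: (deg_sum aP) => l' _.
have scd d c e : A_ d e -> A_ d (e * sc c).
  by rewrite -{2}[d]addr0 => de; apply: (A_mul P de); apply: (sc_deg P).
have sc00 d e : A_ d (e * sc 0) by rewrite (sc0 P) mulr0; apply: deg0 aP _.
rewrite /diag_mat mxE; move: (ri l'); rewrite /nb_degs.
case: (split_ordP l) => l1 ->; case: (split_ordP l') => l2 ->;
  rewrite ?(unsplitK (inl _)) ?(unsplitK (inr _))
    ?block_mxEul ?block_mxEur ?block_mxEdl ?block_mxEdr ?mxE => rd.
- exact: scd.
- exact: sc00.
- exact: sc00.
exact: scd.
Qed.

Definition diag_hom : grhom (F n a b) (F n a' b') :=
  @GrHom _ _ (F n a b) (F n a' b') (mulmxr diag_mat) diag_deg.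

End Diagonal.

Lemma diag_matM a b a' b' a'' b'' (al : 'M[k]_(a, a')) (be : 'M[k]_(b, b'))
    (al' : 'M[k]_(a', a'')) (be' : 'M[k]_(b', b'')) :
  diag_mat al be *m diag_mat al' be' = diag_mat (al *m al') (be *m be').
Proof.
have -> : diag_mat (al *m al') (be *m be') =
    map_mx sc (block_mx al 0 0 be *m block_mx al' 0 0 be').
  by rewrite mulmx_block !(mulmx0, mul0mx, addr0, add0r).
apply/matrixP => i j; rewrite !mxE.
rewrite (big_morph sc scD (sc0 P)); apply: eq_bigr => l _.
by rewrite !mxE (sc_mul P).
Qed.

Section Square.
Variables (M N : grmod A_) (f : grhom M N) (n : int).
Variables (a b : nat) (u : 'I_a -> M) (v : 'I_b -> M) (nb : normal_basis sc x y n u v).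
Variables (a' b' : nat) (u' : 'I_a' -> N) (v' : 'I_b' -> N).
Variable nb' : normal_basis sc x y n u' v'.

(** A homomorphism commutes with x and y, so it respects x M_(n-1) and y M_(n-1),
and its matrix in the two bases is block diagonal with entries in k. *)
Lemma hom_diag : exists al be, forall r,
  nb_hom P nb' (diag_hom n al be r) = f (nb_hom P nb r).
Proof.
have /choice[c cE] : forall i, exists c : 'I_a' -> k,
    f (u i) = \sum_j sc (c j) *: u' j.
  move=> i; have [/(_ i)[w wn ->] _ _] := nb_x nb; rewrite linearZ.
  by apply: (nb_spanx nb'); apply: gh_deg.
have /choice[d dE] : forall i, exists d : 'I_b' -> k,
    f (v i) = \sum_j sc (d j) *: v' j.
  move=> i; have [/(_ i)[w wn ->] _ _] := nb_y nb; rewrite linearZ.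
  by apply: (nb_spany nb'); apply: gh_deg.
exists (\matrix_(i, j) c i j), (\matrix_(i, j) d i j) => r.
rewrite /= /free_fun linear_sum.
under eq_bigr do rewrite mxE scaler_suml.
rewrite exchange_big; apply: eq_bigr => l _.
rewrite linearZ; under eq_bigr do rewrite -scalerA.
rewrite -scaler_sumr; congr (_ *: _).
rewrite big_split_ord /= /diag_mat /nb_gens.
under eq_bigr do rewrite (unsplitK (inl _)).
under [X in _ + X]eq_bigr do rewrite (unsplitK (inr _)).
case: (split_ordP l) => i ->.
  rewrite cE [X in _ + X = _]big1 ?addr0 => [|j _]; last first.
    by rewrite mxE block_mxEur mxE (sc0 P) scale0r.
  by apply: eq_bigr => j _; rewrite mxE block_mxEul mxE.
rewrite linearZ /= dE scaler_sumr big1 ?add0r => [|j _]; last first.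
  by rewrite mxE block_mxEdl mxE (sc0 P) scale0r.
apply: eq_bigr => j _; rewrite mxE block_mxEdr mxE !scalerA.
by rewrite (sc_central P).
Qed.

End Square.

Section Frame.
Variables (M : grmod A_) (n : int) (a b : nat) (u : 'I_a -> M) (v : 'I_b -> M).
Variable nb : normal_basis sc x y n u v.

(** The isomorphism in the quotient category between M and the free module on a
basis of M in degree n. *)
Definition frame : Defs.hom (F n a b : Q) M :=
  zz_of (serre_iso (fdim sc (A_ := A_))) (nb_hom P nb : Defs.hom (F n a b : gr A_) M).

Lemma frame_inverse : exists g, inverse frame g.
Proof.
exists (zz_inv (nb_hom_serre_iso P nb)); split; [exact: zz_invl | exact: zz_invr].
Qed.
End Frame.

Definition diagq n a b a' b' (al : 'M[k]_(a, a')) (be : 'M[k]_(b, b')) :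
    Defs.hom (F n a b : Q) (F n a' b') :=
  zz_of (serre_iso (fdim sc (A_ := A_)))
    (diag_hom n al be : Defs.hom (F n a b : gr A_) (F n a' b')).

Lemma diagqM n a b a' b' a'' b'' (al : 'M[k]_(a, a')) (be : 'M[k]_(b, b'))
    (al' : 'M[k]_(a', a'')) (be' : 'M[k]_(b', b'')) :
  heq (Defs.comp (diagq n al' be') (diagq n al be))
      (diagq n (al *m al') (be *m be')).
Proof.
apply: heq_sym; apply: heq_trans; last exact: zz_of_comp.
by apply: zz_of_eq => r /=; rewrite -diag_matM mulmxA.
Qed.

Lemma diagq_quasi_inverse n a b a' b' (al : 'M[k]_(a, a')) (be : 'M[k]_(b, b')) :
  quasi_inverse (diagq n al be) (diagq n (pinvmx al) (pinvmx be)).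
Proof.
apply: heq_trans; first by apply: comp_heq (diagqM _ _ _ _ _) (heq_refl _).
apply: heq_trans; first exact: diagqM.
have E p q (m : 'M[k]_(p, q)) : m *m (pinvmx m *m m) = m.
  by rewrite mulmxA mulmxKpV.
by rewrite !E; apply: heq_refl.
Qed.

(** The quantification over all large n and all bases in degree n makes this
property stable under composition. *)
Definition tracked (M N : Q) (f : Defs.hom M N) : Prop :=
  exists n0 : int, forall n, (n0 <= n)%R ->
  forall a b (u : 'I_a -> gm_mod M) (v : 'I_b -> gm_mod M)
    (nb : normal_basis sc x y n u v)
    a' b' (u' : 'I_a' -> gm_mod N) (v' : 'I_b' -> gm_mod N)
    (nb' : normal_basis sc x y n u' v'),
  exists al be, heq (Defs.comp (frame nb') (diagq n al be)) (Defs.comp f (frame nb)).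

Lemma tracked_of (M N : grmod A_) (f : Defs.hom (M : gr A_) N) :
  tracked (zz_of (serre_iso (fdim sc (A_ := A_))) f).
Proof.
exists 0 => n _ a b u v nb a' b' u' v' nb'.
have [al [be E]] := hom_diag f nb nb'; exists al, be.
apply: heq_trans; first by apply: heq_sym; apply: zz_of_comp.
apply: heq_trans; last exact: zz_of_comp.
exact: zz_of_eq.
Qed.

(** Induction on the zigzag that presents f. A formal inverse of s is represented
by the pseudo-inverse of the matrix of s; for a composite, a basis of the middle
object is chosen. *)
Lemma all_tracked (M N : Q) (f : Defs.hom M N) : tracked f.
Proof.
elim: f => {M N} [M N f|M N f Wf|L M N g [n1 gT] f [n2 fT]].
- exact: tracked_of.
- have [n0 fT] := tracked_of f; exists n0 => n nn a b u v nb a' b' u' v' nb'.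
  have [al [be E]] := fT n nn _ _ _ _ nb' _ _ _ _ nb.
  have [i ii] := frame_inverse nb; have [j jj] := frame_inverse nb'.
  exists (pinvmx al), (pinvmx be).
  apply: inverse_square jj ii E (diagq_quasi_inverse _ _ _) _.
  by split; [apply: zz_invl | apply: zz_invr].
have [n3 nbE] := normal_basis_exists P M.
exists (Num.max n1 (Num.max n2 n3)) => n.
rewrite !ge_max => /and3P[nn1 nn2 nn3] a b u v nb a'' b'' u'' v'' nb''.
have [a' [b' [u' [v' nb']]]] := nbE n nn3.
have [al [be E]] := fT n nn2 _ _ _ _ nb _ _ _ _ nb'.
have [al' [be' E']] := gT n nn1 _ _ _ _ nb' _ _ _ _ nb''.
exists (al *m al'), (be *m be').
apply: heq_trans; last exact: square_comp E E'.
by apply: comp_heq (heq_refl _) (heq_sym _); apply: diagqM.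
Qed.

Lemma qgr_regular (M N : Q) (f : Defs.hom M N) : exists g, quasi_inverse f g.
Proof.
have [n0 fT] := all_tracked f.
have [n1 nbM] := normal_basis_exists P M; have [n2 nbN] := normal_basis_exists P N.
pose n := Num.max n0 (Num.max n1 n2).
have /and3P[nn0 nn1 nn2] : [&& n0 <= n, n1 <= n & n2 <= n]%R.
  by rewrite -!ge_max.
have [a [b [u [v nb]]]] := nbM n nn1; have [a' [b' [u' [v' nb']]]] := nbN n nn2.
have [al [be E]] := fT n nn0 _ _ _ _ nb _ _ _ _ nb'.
have [i ii] := frame_inverse nb; have [j jj] := frame_inverse nb'.
exists (Defs.comp (Defs.comp (frame nb) (diagq n (pinvmx al) (pinvmx be))) j).
exact: quasi_inverse_transport ii jj E (diagq_quasi_inverse _ _ _).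
Qed.

End QuotientCategory.

Theorem corollary1p2 (k : fieldType) (M : qgrB k) :
  injective_obj M /\ projective_obj M.
Proof. exact: regular_inj_proj (qgr_regular (penrose_B k)) M. Qed.
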